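(* Let $\Omega\subset\mathbb{R}^d$ be a bounded open set with Lipschitz boundary and let $|\cdot|_*$ be a norm on $\mathbb{R}^d$. Let $K$ be a kernel on $\mathbb{R}^d$ such that: (i) there is $c_0\in(0,1]$ such that $|x|_*\le|y|_*$ implies $K(x)\ge c_0K(y)$; (ii) there are positive constants $D$ and $C_D$ such that $|y|_*=2|x|_*$ and $|x|_*\le D$ imply $K(x)\le C_DK(y)$; (iii) $\int_{\mathbb{R}^d}K(z)\min\{1,|z|_2\}\,dz<+\infty$. Assume that for some $q\in[1,+\infty)$ there is a positive constant $C_1$ such that $\mathcal{P}_{K^*}(B^m)\ge m^{1/q}/C_1$ for every $m>0$. Then $W^{K,1}(\Omega)$ is continuously embedded in $L^q(\Omega)$; that is, there exists a positive constant $C$ such that $$\|u\|_{L^q(\Omega)}\le C\|u\|_{W^{K,1}(\Omega)}\qquad\text{for every }u\in W^{K,1}(\Omega).$$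
   Context: Here $d\ge1$ and $|\cdot|_2$ is the Euclidean norm. A kernel is a measurable function $K:\mathbb{R}^d\to[0,+\infty]$ that is not a.e. equal to $0$. For an open set $\Omega\subset\mathbb{R}^d$, $[u]_{W^{K,1}(\Omega)}:=\int_{\Omega}\int_\Omega|u(x)-u(y)|K(x-y)\,dx\,dy\in[0,+\infty]$, $W^{K,1}(\Omega):=\{u\in L^1(\Omega):[u]_{W^{K,1}(\Omega)}<+\infty\}$, and $\|u\|_{W^{K,1}(\Omega)}:=\|u\|_{L^1(\Omega)}+[u]_{W^{K,1}(\Omega)}$. For $m>0$, $B^m$ is the open Euclidean ball centred at the origin with Lebesgue measure $m$. For a measurable set $A$ with finite measure $|A|$, $A^*:=B^{|A|}$ (with $A^*=\emptyset$ if $|A|=0$). The symmetric-decreasing rearrangement of $K$ is $K^*(x):=\int_0^{+\infty}\mathbf{1}_{\{K>t\}^*}(x)\,dt$. For a kernel $J$ and a measurable set $E\subset\mathbb{R}^d$, $\mathcal{P}_J(E):=\frac12\int_{\mathbb{R}^d}\int_{\mathbb{R}^d}|\mathbf{1}_E(x)-\mathbf{1}_E(y)|J(x-y)\,dx\,dy$. *)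

(* Defs.v *)
From HB Require Import structures.
From mathcomp Require Import all_boot all_order all_algebra.
From mathcomp Require Import all_classical all_reals all_analysis.
From mathcomp Require Import measurable_realfun.

Set Implicit Arguments.
Unset Strict Implicit.
Unset Printing Implicit Defensive.

Import Order.TTheory GRing.Theory Num.Theory.
Import numFieldNormedType.Exports.

Local Open Scope classical_set_scope.
Local Open Scope ring_scope.

(* Lebesgue measure on R^n, carried by row vectors, is built in two steps:
   - [lebesgue_borel R n], the n-fold product of [lebesgue_measure] on the
     product sigma-algebra ([borel_rV R n]), characterized on products of
     measurable sets by [lebesgue_borel_box];
   - [lebesgue_rV R n], its completion, on the sigma-algebra of Lebesgue
     measurable sets ([lebesgue_type R n]). *)

Definition coord_rV (R : realType) (n : nat) (i : 'I_n) (x : 'rV[R]_n) :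
  measurableTypeR R := x ord0 i.

Definition borel_rV (R : realType) (n : nat) : Type := 'rV[R]_n.

Section borel_rV.
Context {R : realType} (n : nat).

HB.instance Definition _ := Pointed.on (borel_rV R n).

Let coord_set0 : g_sigma_preimage (@coord_rV R n) set0.
Proof. exact: sigma_algebra0. Qed.

Let coord_setC A :
  g_sigma_preimage (@coord_rV R n) A -> g_sigma_preimage (@coord_rV R n) (~` A).
Proof. exact: sigma_algebraC. Qed.

Let coord_bigcup (F : (set 'rV[R]_n)^nat) :
  (forall i, g_sigma_preimage (@coord_rV R n) (F i)) ->
  g_sigma_preimage (@coord_rV R n) (\bigcup_i (F i)).
Proof. exact: sigma_algebra_bigcup. Qed.

HB.instance Definition _ := @isMeasurable.Build default_measure_display
  (borel_rV R n) (g_sigma_preimage (@coord_rV R n))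
  coord_set0 coord_setC coord_bigcup.

End borel_rV.

Lemma measurable_coord_rV (R : realType) (n : nat) (i : 'I_n) :
  measurable_fun [set: borel_rV R n] (@coord_rV R n i).
Proof.
move=> _ Y mY; rewrite setTI; apply: sub_sigma_algebra => /=.
rewrite -bigcup_seq/=; exists i => /=; first by rewrite mem_index_enum.
by exists Y => //; rewrite setTI.
Qed.

Lemma measurable_fun_rV d (T : measurableType d) (R : realType) (n : nat)
    (f : T -> borel_rV R n) :
  (forall i, measurable_fun [set: T] (@coord_rV R n i \o f)) ->
  measurable_fun [set: T] f.
Proof.
move=> mf _ Y mY; rewrite setTI.
suff : @g_sigma_preimage _ _ _ n (@coord_rV R n)
    `<=` [set A : set (borel_rV R n) | measurable (f @^-1` A)].
  exact.
apply: smallest_sub => /=.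
  split => /=.
  - by rewrite preimage_set0.
  - by move=> A mA; rewrite setTD preimage_setC; exact: measurableC.
  - by move=> F mF; rewrite preimage_bigcup; exact: bigcup_measurable.
rewrite -bigcup_seq => A [i _ [B mB <-]] /=.
by rewrite setTI -[X in measurable X]setTI; exact: (mf i).
Qed.

Section lebesgue_step.
Context {R : realType} (n : nat).
Variable m : {sigma_finite_measure set (borel_rV R n) -> \bar R}.

Definition cons_rV (p : measurableTypeR R * borel_rV R n) : borel_rV R n.+1 :=
  \row_(i < n.+1) if unlift ord0 i is Some j then p.2 ord0 j else p.1.

Definition uncons_rV (x : borel_rV R n.+1) : measurableTypeR R * borel_rV R n :=
  (x ord0 ord0, \row_(i < n) x ord0 (lift ord0 i)).

Lemma cons_rVK : cancel cons_rV uncons_rV.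
Proof.
case=> a v; rewrite /uncons_rV/= mxE unlift_none; congr pair.
by apply/rowP => i; rewrite !mxE liftK.
Qed.

Lemma measurable_cons_rV : measurable_fun setT cons_rV.
Proof.
apply: measurable_fun_rV => i.
have [j ->|->] := unliftP ord0 i.
- rewrite (_ : _ \o _ = @coord_rV R n j \o snd).
    exact: measurableT_comp (measurable_coord_rV j) measurable_snd.
  by apply/funext => p; rewrite /= /coord_rV mxE liftK.
- rewrite (_ : _ \o _ = fst); first exact: measurable_fst.
  by apply/funext => p; rewrite /= /coord_rV mxE unlift_none.
Qed.

Lemma measurable_uncons_rV : measurable_fun setT uncons_rV.
Proof.
apply: measurable_fun_pair => /=; first exact: (measurable_coord_rV ord0).
apply: measurable_fun_rV => i; rewrite (_ : _ \o _ = @coord_rV R n.+1 (lift ord0 i)).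
  exact: measurable_coord_rV.
by apply/funext => x; rewrite /= /coord_rV mxE.
Qed.

Definition lebesgue_step : set (borel_rV R n.+1) -> \bar R :=
  pushforward (@lebesgue_measure R \x m)%E cons_rV.

Let step0 : lebesgue_step set0 = 0%E.
Proof. by rewrite /lebesgue_step /pushforward preimage_set0 measure0. Qed.

Let step_ge0 A : (0 <= lebesgue_step A)%E.
Proof. by rewrite /lebesgue_step /pushforward; exact: measure_ge0. Qed.

Let step_sigma_additive : semi_sigma_additive lebesgue_step.
Proof.
apply: (@measure_semi_sigma_additive _ _ _ (pushforward _ _)).
exact: measurable_cons_rV.
Qed.

HB.instance Definition _ := isMeasure.Build _ _ _ lebesgue_step
  step0 step_ge0 step_sigma_additive.

Let step_sigma_finite : sigma_finite setT lebesgue_step.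
Proof.
have /sigma_finiteP[F [FT ndF Foo]] := sigma_finiteT (@lebesgue_measure R).
have /sigma_finiteP[G [GT ndG Goo]] := sigma_finiteT m.
exists (fun k => uncons_rV @^-1` (F k `*` G k)).
  rewrite -preimage_bigcup (_ : \bigcup_k _ = setT) ?preimage_setT//.
  apply/seteqP; split => // -[x y] _.
  have [i _ Fix] : (\bigcup_k F k) x by rewrite -FT.
  have [j _ Gjy] : (\bigcup_k G k) y by rewrite -GT.
  exists (maxn i j) => //; split => /=.
  - by move: x Fix; exact/subsetPset/ndF/leq_maxl.
  - by move: y Gjy; exact/subsetPset/ndG/leq_maxr.
move=> k; have [mF Fk] := Foo k; have [mG Gk] := Goo k; split.
  rewrite -[X in measurable X]setTI; apply: measurable_uncons_rV => //.
  exact: measurableX.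
rewrite /lebesgue_step /pushforward -comp_preimage.
rewrite (_ : uncons_rV \o cons_rV = id); last first.
  by apply/funext => p/=; exact: cons_rVK.
by rewrite preimage_id product_measure1E// lte_mul_pinfty// ge0_fin_numE.
Qed.

HB.instance Definition _ := Measure_isSigmaFinite.Build _ _ _ lebesgue_step
  step_sigma_finite.

End lebesgue_step.

Fixpoint lebesgue_borel (R : realType) (n : nat) :
    {sigma_finite_measure set (borel_rV R n) -> \bar R} :=
  if n is n'.+1 then lebesgue_step (lebesgue_borel R n')
  else @dirac _ (borel_rV R 0) (0 : 'rV[R]_0) R.

Lemma lebesgue_borel_box (R : realType) (n : nat)
    (A : 'I_n -> set (measurableTypeR R)) :
  (forall i, measurable (A i)) ->
  measurable ([set x | forall i, A i (coord_rV i x)] : set (borel_rV R n)) /\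
  lebesgue_borel R n [set x | forall i, A i (coord_rV i x)] =
  (\prod_(i < n) lebesgue_measure (A i))%E.
Proof.
move=> mA.
have mB k (C : 'I_k -> set (measurableTypeR R)) : (forall i, measurable (C i)) ->
    measurable ([set x | forall i, C i (coord_rV i x)] : set (borel_rV R k)).
  move=> mC; rewrite (_ : [set x | _] = \bigcap_(i in [set: 'I_k])
      (@coord_rV R k i @^-1` C i)).
    apply: fin_bigcap_measurable => // i _; rewrite -[X in measurable X]setTI.
    exact: measurable_coord_rV.
  by apply/seteqP; split => x /= H; [move=> i _|move=> i]; exact: H.
split; first exact: mB.
elim: n A mA => [A mA|n IH A mA] /=.
  by rewrite big_ord0 diracE mem_set//= => -[].
rewrite big_ord_recl /lebesgue_step /pushforward.
rewrite -(IH (fun i => A (lift ord0 i)))//.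
have mS := mB n (fun i => A (lift ord0 i)) (fun i => mA _).
rewrite -product_measure1E//.
congr (_ _); apply/seteqP; split => [[a v]|[a v]] /=.
- move=> H; split => /=.
    by have := H ord0; rewrite /coord_rV mxE unlift_none.
  by move=> i; have := H (lift ord0 i); rewrite /coord_rV mxE liftK.
- case=> /= A0 H i; rewrite /coord_rV mxE.
  by have [j ->|->] := unliftP ord0 i; [exact: H|].
Qed.

Definition lebesgue_type (R : realType) (n : nat) : Type :=
  caratheodory_type (mu_ext (lebesgue_borel R n)).

HB.instance Definition _ (R : realType) (n : nat) :=
  Measurable.on (lebesgue_type R n).

Definition lebesgue_rV (R : realType) (n : nat) :
    set (lebesgue_type R n) -> \bar R :=
  @completed_measure_extension _ _ _ (lebesgue_borel R n).

HB.instance Definition _ (R : realType) (n : nat) :=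
  Measure.on (@lebesgue_rV R n).

Section notions.
Context {R : realType} {d : nat}.
Local Notation Rd := 'rV[R]_d.
Local Notation mu := (@lebesgue_rV R d).
Implicit Types (x y : Rd) (A E Omega : set Rd) (K J : Rd -> \bar R)
  (u : Rd -> R).

(* the library norm [`|x|] on row vectors is the sup norm *)
Definition enorm x : R := Num.sqrt (\sum_(i < d) x ord0 i ^+ 2).

Definition eball (r : R) : set Rd := [set x | enorm x < r].

Definition is_norm (N : Rd -> R) : Prop :=
  [/\ forall x, N x = 0 -> x = 0,
      forall (a : R) x, N (a *: x) = `|a| * N x &
      forall x y, N (x + y) <= N x + N y].

Definition is_kernel K : Prop :=
  [/\ forall x, (0 <= K x)%E,
      measurable_fun [set: lebesgue_type R d] (K : lebesgue_type R d -> \bar R) &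
      ~ {ae mu, forall x, K x = 0%E}].

(* B^m, meaningful for m > 0 *)
Definition ball_vol (m : R) : set Rd :=
  eball (get [set r : R | 0 < r /\ mu (eball r) = m%:E]).

(* A^*, meaningful for mu A < +oo; a set of infinite measure is sent to a ball
   with an irrelevant radius. For K such that K(z) min(1, |z|) is integrable the
   superlevel sets {K > t}, t > 0, have finite measure. *)
Definition set_rearr A : set Rd :=
  if mu A == 0%E then set0 else ball_vol (fine (mu A)).

Definition fun_rearr K : Rd -> \bar R := fun x =>
  (\int[lebesgue_measure]_(t in `]0%R, +oo[)
     (\1_(set_rearr [set y | (t%:E < K y)%E]) x)%:E)%E.

Definition perimeter J E : \bar R :=
  ((2^-1 : R)%:E * \int[mu]_y \int[mu]_x
    (`|\1_E x - \1_E y|%:E * J ((x : Rd) - y)%R))%E.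

Definition seminormWK1 K Omega u : \bar R :=
  (\int[mu]_(y in Omega) \int[mu]_(x in Omega)
    (`|u x - u y|%:E * K ((x : Rd) - y)%R))%E.

(* ||u||_{L^q(Omega)}: [\_] extends u by 0 outside of Omega *)
Definition normL (q : R) Omega u : \bar R :=
  'N[mu]_(q%:E)[(EFin \o u) \_ Omega].

(* representatives are functions on R^d whose values outside of Omega are
   unconstrained and ignored *)
Definition WK1 K Omega : set (Rd -> R) := [set u |
  mu.-integrable Omega (EFin \o u) /\ (seminormWK1 K Omega u < +oo)%E].

Definition normWK1 K Omega u : \bar R :=
  (normL 1 Omega u + seminormWK1 K Omega u)%E.

(* Near each boundary point, in suitable orthonormal coordinates x *m Q, Omega
   is the strict epigraph, in the direction of the i-th coordinate, of a
   Lipschitz function of the other d - 1 coordinates. *)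
Definition lipschitz_boundary Omega : Prop :=
  forall x0 : Rd, (closure Omega `\` Omega^°) x0 ->
  exists (r : R) (Q : 'M[R]_d) (i : 'I_d) (g : 'rV[R]_d.-1 -> R),
    [/\ 0 < r, Q *m Q^T = 1%:M, [lipschitz g z | z in setT] &
        forall x, enorm (x - x0) < r ->
          (Omega x <-> g (col' i (x *m Q)) < (x *m Q) ord0 i)].

End notions.

(* Main.v *)
(* Write [|.|] for the sup norm and [rho(t)] for the [d]-th root of the measure
   of [{K > t}]. The hypotheses compare [K], level by level, with kernels that
   depend on [|x|] only:
     [K x >= c0 * |{t > 0 : |x| < a * rho(t)}|] and
     [K^* x <= |{t > 0 : |x| < d * rho(t)}|],
   so that it suffices to work at a fixed scale [s].

   At scale [s], the perimeter of a ball of volume [m = r^d] is at most a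
   constant times [s^d * r^d * s / (s + r)] (volume of an annulus). Conversely,
   the perimeter relative to [Omega] of any [E] inside [Omega] of small volume
   [m = r^d] is at least a constant times the same quantity. Indeed [Omega] has
   a uniform interior cone property, so that points of [E] near a given
   boundary patch may be translated by [T * w], for [w] in a small ball, without
   leaving [Omega]. For [T] of order [r], on average over [w], at least half of
   these points are moved out of [E]; if the translation is cut into [k] steps,
   one step moves at least one [k]-th of that mass out of [E]. No extension
   operator and no Riesz rearrangement inequality is involved.

   Integrating over [t], the isoperimetric hypothesis on [K^*] becomes
     [|E|^(1/q) <= A * (relative perimeter of E + |E|)],
   the large scales being absorbed in [|E|] since the tail of [K] is integrable.
   Applied to the superlevel sets of [|u|], this gives the embedding by the
   coarea formula and [||u||_q <= 2 * \int_0^oo |{|u| > s}|^(1/q) ds]. *)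

Require Import Defs.
From HB Require Import structures.
From mathcomp Require Import all_boot all_order all_algebra.
From mathcomp Require Import all_classical all_reals all_analysis.
From mathcomp Require Import measurable_realfun lra.

Import Order.TTheory GRing.Theory Num.Theory.
Import numFieldNormedType.Exports.

Local Open Scope classical_set_scope.
Local Open Scope ring_scope.

(* The map [(x, y) |-> K (x - y)] need not be measurable for the product of the
   Lebesgue sigma-algebras. Seminorms and perimeters are therefore never computed
   but only compared, by monotonicity alone, with integrals of Borel functions. *)
Lemma le_ge0_integral d (T : measurableType d) (R : realType)
    (mu : {measure set T -> \bar R}) (D : set T) (f g : T -> \bar R) :
  (forall x, D x -> (0 <= f x)%E) -> (forall x, D x -> (f x <= g x)%E) ->
  (\int[mu]_(x in D) f x <= \int[mu]_(x in D) g x)%E.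
Proof.
move=> f0 fg.
have g0 x : D x -> (0 <= g x)%E by move=> Dx; exact: le_trans (f0 _ Dx) (fg _ Dx).
rewrite !ge0_integralE//; apply: le_ereal_sup => _ [h hf <-]; exists h => // x.
apply: le_trans (hf x) _; rewrite /patch; case: ifPn => // /[!inE]; exact: fg.
Qed.

(** Agreement of two measures on measurable sets passes to integrals. The factor [c] covers
    dilations; [c = 1] with the identity map compares the completed measure with the Borel one. *)
Lemma ge0_integral_comp_scaled d1 d2 (T1 : measurableType d1)
    (T2 : measurableType d2) (R : realType) (m1 : {measure set T1 -> \bar R})
    (m2 : {measure set T2 -> \bar R}) (phi : T1 -> T2) (c : R)
    (f : T2 -> \bar R) :
  measurable_fun [set: T1] phi -> 0 <= c ->
  (forall A, measurable A -> (c%:E * m1 (phi @^-1` A) = m2 A)%E) ->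
  measurable_fun [set: T2] f -> (forall y, 0 <= f y)%E ->
  (c%:E * \int[m1]_x f (phi x) = \int[m2]_y f y)%E.
Proof.
move=> mphi c0 m12 mf f0.
pose nu : {measure set T2 -> \bar R} :=
  measure_function_pushforward__canonical__measure_function_Measure m1 mphi.
transitivity (\int[mscale (NngNum c0) nu]_y f y)%E.
  rewrite ge0_integral_mscale//=; congr (_ * _)%E.
  by rewrite (ge0_integral_pushforward mphi) // => y _; exact: f0.
by apply: eq_measure_integral => A mA _; exact: m12.
Qed.

(** * Lebesgue measure on row vectors *)

Section affine_change_of_variables.
Context {R : realType}.

Lemma measurable_affine (t a : R) : measurable_fun [set: measurableTypeR R]
  (fun x : measurableTypeR R => t * x + a : measurableTypeR R).
Proof. by apply: measurable_funD => //; exact: measurable_funM. Qed.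

(** The scaled pushforward gives each interval []u, v]] its length, and these intervals determine
    Lebesgue measure. *)
Lemma lebesgue_measure_affine (t a : R) (A : set (measurableTypeR R)) :
  0 < t -> measurable A ->
  (t%:E * lebesgue_measure ((fun x : R => (t * x + a)%R) @^-1` A) =
   lebesgue_measure A)%E.
Proof.
move=> t0 mA.
pose nu : {measure set (measurableTypeR R) -> \bar R} :=
  measure_function_pushforward__canonical__measure_function_Measure
    (@lebesgue_measure R) (measurable_affine t a).
rewrite -[LHS]/(mscale (NngNum (ltW t0)) nu A).
apply/esym/lebesgue_measure_unique => // _ [[u v] _ <-] /=.
rewrite /mscale/= /pushforward.
have -> : (fun x : R => t * x + a) @^-1` `]u, v] =
    `]((u - a) / t), ((v - a) / t)]%classic.
  apply/seteqP; split=> x /=; rewrite !in_itv/= ltr_pdivrMr// ler_pdivlMr//;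
  by rewrite ltrBlDr lerBrDr (mulrC x).
rewrite !lebesgue_measure_itv/= !lte_fin ltr_pM2r ?invr_gt0// ltrD2r.
case: ifPn => _; last by rewrite mule0.
rewrite -!EFinB -EFinM -mulrBl mulrC divfK ?gt_eqF//.
by congr EFin; lra.
Qed.

Lemma ge0_integral_lebesgue_affine (t a : R) (f : measurableTypeR R -> \bar R) :
  0 < t -> measurable_fun setT f -> (forall x, 0 <= f x)%E ->
  (t%:E * \int[lebesgue_measure]_x f (t * x + a)%R =
   \int[lebesgue_measure]_x f x)%E.
Proof.
move=> t0 mf f0.
apply: (@ge0_integral_comp_scaled _ _ _ _ _ _ lebesgue_measure
  (fun x : measurableTypeR R => t * x + a : measurableTypeR R)) => //.
- exact: measurable_affine.
- exact: ltW.
- by move=> A; exact: lebesgue_measure_affine.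
Qed.

Lemma measurable_affine_rV n (t : R) (a : 'rV[R]_n) :
  measurable_fun [set: borel_rV R n] (fun x : borel_rV R n => t *: x + a : borel_rV R n).
Proof.
apply: measurable_fun_rV => i.
rewrite (_ : _ \o _ = (fun x : measurableTypeR R => t * x + a ord0 i : measurableTypeR R) \o
   @coord_rV R n i); last by apply/funext => x; rewrite /coord_rV/= !mxE.
by apply: measurableT_comp (measurable_coord_rV i); exact: measurable_affine.
Qed.

(** Induction on [n], peeling off the first coordinate with [cons_rV]: the outer integral
    contributes one factor [t], and the sections contribute [t ^+ n] by induction. *)
Lemma lebesgue_borel_affine n (t : R) (a : 'rV[R]_n) (A : set (borel_rV R n)) :
  0 < t -> measurable A ->
  ((t ^+ n)%:E * lebesgue_borel R n ((fun x : borel_rV R n => (t *: x + a)%R) @^-1` A) =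
   lebesgue_borel R n A)%E.
Proof.
move=> t0; elim: n a A => [|n IH] a A mA.
  rewrite expr0 mul1e; congr (lebesgue_borel R 0 _).
  apply/funext => x; congr A; by apply/rowP => -[].
pose a' : 'rV[R]_n := \row_(i < n) a ord0 (lift ord0 i).
have consE x v : t *: (@cons_rV R n (x, v)) + a = cons_rV (t * x + a ord0 ord0, t *: v + a').
  apply/rowP => i; rewrite !mxE.
  by have [j ->|->] := unliftP ord0 i; rewrite /= ?mxE.
rewrite /= /lebesgue_step /pushforward.
set B := @cons_rV R n @^-1` A; set B' := @cons_rV R n @^-1` _.
have mB : measurable B by rewrite -[X in measurable X]setTI; exact: measurable_cons_rV.
rewrite /product_measure1.
pose F x := lebesgue_borel R n (xsection B x).
have F0 x : (0 <= F x)%E by [].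
have mF : measurable_fun [set: measurableTypeR R] F by exact: measurable_fun_xsection.
rewrite -[RHS](@ge0_integral_lebesgue_affine t (a ord0 ord0) F)//.
rewrite exprS EFinM -muleA; congr (_ * _)%E.
rewrite -ge0_integralZl//; last first.
- by rewrite lee_fin exprn_ge0// ltW.
- apply: measurable_fun_xsection.
  rewrite /B' -[X in measurable X]setTI; apply: measurable_cons_rV => //.
  by rewrite -[X in measurable X]setTI; exact: measurable_affine_rV.
apply: eq_integral => x _; rewrite /F -[RHS](IH a'); last exact: measurable_xsection.
congr (_ * lebesgue_borel R n _)%E.
by apply/seteqP; split => v /=; rewrite /xsection/= !inE /B' /B/= consE.
Qed.


End affine_change_of_variables.

Section borel_sets.
Context {R : realType} {n : nat}.
Implicit Types (x y a : 'rV[R]_n) (r : R).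

Lemma norm_rV_lt x r : 0 < r -> (`|x| < r) <-> (forall i, `|x ord0 i| < r).
Proof.
move=> r0; rewrite -[`|x|]/(mx_norm x) mx_normrE; split.
  by move/bigmax_ltP => /= [_ H] i; exact: (H (ord0, i)).
by move=> H; apply/bigmax_ltP; split => //= -[i j] _ /=; rewrite ord1; exact: H.
Qed.

Lemma norm_rV_le x r : 0 <= r -> (`|x| <= r) <-> (forall i, `|x ord0 i| <= r).
Proof.
move=> r0; rewrite -[`|x|]/(mx_norm x) mx_normrE; split.
  by move/bigmax_leP => /= [_ H] i; exact: (H (ord0, i)).
by move=> H; apply/bigmax_leP; split => //= -[i j] _ /=; rewrite ord1; exact: H.
Qed.

Lemma ball_rVE a r : 0 < r ->
  ball a r = [set x | forall i, ball (a ord0 i : R) r (coord_rV i x)].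
Proof.
move=> r0; apply/seteqP; split => x.
  rewrite -ball_normE /ball_ /= => /norm_rV_lt H i.
  by rewrite -ball_normE /ball_/=; have := H r0 i; rewrite !mxE.
move=> /= H; rewrite -ball_normE /ball_ /=; apply/norm_rV_lt => // i; rewrite !mxE.
by have := H i; rewrite -ball_normE.
Qed.

Let measurable_ball_coord a r i :
  measurable (ball (a ord0 i : R) r : set (measurableTypeR R)).
Proof. exact: measurable_ball. Qed.

Lemma measurable_ball_rV a r : measurable (ball a r : set (borel_rV R n)).
Proof.
have [r0|r0] := ltP 0 r.
  rewrite ball_rVE//.
  by have [] := @lebesgue_borel_box R n _ (measurable_ball_coord a r).
rewrite (_ : ball a r = set0) //; apply/seteqP; split => // x.
by rewrite -ball_normE /ball_/= => /lt_le_trans/(_ r0); rewrite normr_lt0.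
Qed.

(** Balls are those of the sup norm, hence cubes of side [2 * r]. *)
Lemma lebesgue_borel_ball a r : 0 < r ->
  lebesgue_borel R n (ball a r) = ((2 * r) ^+ n)%:E.
Proof.
move=> r0; rewrite ball_rVE//.
have [_ ->] := @lebesgue_borel_box R n _ (measurable_ball_coord a r).
under eq_bigr => i _ do rewrite lebesgue_measure_ball ?ltW//.
by rewrite prodEFin prodr_const card_ord mulr_natl.
Qed.

Lemma measurable_norm_rV :
  measurable_fun [set: borel_rV R n] (fun x : borel_rV R n => `|x : 'rV[R]_n| : R).
Proof.
move=> mT; apply: (measurability _ (RGenInftyO.measurableE R)) => //= _ [_ [r ->] <-].
rewrite setTI (_ : _ @^-1` _ = ball (0 : 'rV[R]_n) r); first exact: measurable_ball_rV.
by apply/seteqP; split => x/=; rewrite -ball_normE /ball_/= add0r normrN in_itv.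
Qed.

(** [U] is the union of the balls with rational centre and radius [1 / (k + 1)] that it contains, a
    countable family. *)
Lemma open_measurable_rV (U : set 'rV[R]_n) : open U ->
  measurable (U : set (borel_rV R n)).
Proof.
move=> oU.
pose c (p : 'rV[rat]_n) : 'rV[R]_n := map_mx ratr p.
pose B (p : 'rV[rat]_n * nat) := ball (c p.1) (p.2.+1%:R^-1 : R).
rewrite (_ : U = \bigcup_p if `[< B p `<=` U >] then B p else set0).
  apply: countable_bigcupT_measurable => // p.
  by case: ifPn => // _; exact: measurable_ball_rV.
apply/seteqP; split => x; last by move=> [p _]; case: asboolP => // pU /pU.
move=> Ux.
have /nbhs_ballP[e /= e0 xeU] : nbhs x U by exact: open_nbhs_nbhs.
have [k ke] : exists k, (k.+1%:R^-1 : R) < e / 2.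
  have e20 : 0 < e / 2 by rewrite divr_gt0.
  have /cvgrPdist_lt/(_ _ e20)[k _ /(_ k (leqnn k))] := @cvg_harmonic R.
  by rewrite /harmonic/= sub0r normrN ger0_norm//; exists k.
have k0 : 0 < (k.+1%:R^-1 : R) by [].
have [f fE] : exists f : R, f = k.+1%:R^-1 by exists k.+1%:R^-1.
rewrite -fE in ke k0.
have /choice[p hp] : forall i, exists p : rat, `|x ord0 i - ratr p| < f.
  move=> i; have [|p] := @rat_in_itvoo R (x ord0 i - f) (x ord0 i + f).
    by lra.
  rewrite in_itv/= => /andP[p1 p2]; exists p; rewrite ltr_norml; lra.
have xp : ball (c (\row_i p i)) f x.
  rewrite -ball_normE /ball_/= distrC; apply/norm_rV_lt => // i; rewrite !mxE.
  exact: hp.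
exists (\row_i p i, k) => //; rewrite /B/= -fE; case: asboolP => // -[] y yp; apply: xeU.
apply: (@le_ball _ _ _ (f + f)); first by lra.
by apply: ball_triangle yp; exact: ball_sym.
Qed.

End borel_sets.

Section euclidean_norm.
Context {R : realType} {n : nat}.
Implicit Types (x y : 'rV[R]_n) (t : R).

Lemma coord_rV_le_norm x i : `|x ord0 i| <= `|x|.
Proof. by move: i; apply/norm_rV_le. Qed.

Lemma enorm_ge0 x : 0 <= enorm x.
Proof. exact: sqrtr_ge0. Qed.

Let sumsq_ge0 x : 0 <= \sum_(i < n) x ord0 i ^+ 2.
Proof. by apply: sumr_ge0 => i _; exact: sqr_ge0. Qed.

Lemma enormZ t x : enorm (t *: x) = `|t| * enorm x.
Proof.
rewrite /enorm -sqrtr_sqr -sqrtrM ?sqr_ge0// mulr_sumr.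
by congr Num.sqrt; apply: eq_bigr => i _; rewrite mxE exprMn.
Qed.

Lemma norm_le_enorm x : `|x| <= enorm x.
Proof.
apply/norm_rV_le => [|i]; first exact: enorm_ge0.
rewrite -sqrtr_sqr ler_wsqrtr// (bigD1 i)//= lerDl.
by apply: sumr_ge0 => j _; exact: sqr_ge0.
Qed.

Lemma enorm_le_norm x : enorm x <= n%:R * `|x|.
Proof.
rewrite -[leRHS]ger0_norm ?mulr_ge0// -sqrtr_sqr ler_wsqrtr//.
apply: (@le_trans _ _ (\sum_(i < n) `|x| ^+ 2)).
  apply: ler_sum => i _; rewrite -[leLHS]ger0_norm ?sqr_ge0// normrX.
  by rewrite ler_sqr ?nnegrE//; exact: coord_rV_le_norm.
rewrite sumr_const card_ord -[leLHS]mulr_natl exprMn ler_wpM2r ?sqr_ge0//.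
by rewrite -natrX ler_nat; case: (n) => // m; rewrite expnS leq_pmulr// expn_gt0.
Qed.

Lemma enormD x y : enorm (x + y) <= enorm x + enorm y.
Proof.
set A := \sum_(i < n) x ord0 i ^+ 2; set B := \sum_(i < n) y ord0 i ^+ 2.
set C := \sum_(i < n) x ord0 i * y ord0 i.
have A0 : 0 <= A by exact: sumsq_ge0.
have B0 : 0 <= B by exact: sumsq_ge0.
(* Cauchy-Schwarz: the sum of the squares of [B * x_i - C * y_i] equals [B * (A * B - C ^+ 2)]. *)
have CAB : C ^+ 2 <= A * B.
  have [B00|B0'] := eqVneq B 0.
    have y0 i : y ord0 i = 0.
      apply/eqP; rewrite -sqrf_eq0 eq_le sqr_ge0 andbT -B00.
      rewrite /B (bigD1 i)//= lerDl.
      by apply: sumr_ge0 => j _; exact: sqr_ge0.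
    by rewrite B00 mulr0 /C big1 ?expr0n// => i _; rewrite y0 mulr0.
  have : 0 <= \sum_(i < n) (B * x ord0 i - C * y ord0 i) ^+ 2.
    by apply: sumr_ge0 => i _; exact: sqr_ge0.
  rewrite (eq_bigr (fun i => B ^+ 2 * x ord0 i ^+ 2 +
      (- (2 * B * C) * (x ord0 i * y ord0 i) + C ^+ 2 * y ord0 i ^+ 2))); last first.
    by move=> i _; lra.
  rewrite big_split/= big_split/= -!mulr_sumr -/A -/B -/C.
  rewrite (_ : _ + _ = B * (A * B - C ^+ 2)); last by lra.
  by rewrite pmulr_rge0 ?subr_ge0// lt_neqAle eq_sym B0'.
have CAB' : C <= Num.sqrt A * Num.sqrt B.
  rewrite -sqrtrM//; apply: le_trans (ler_norm _) _.
  by rewrite -sqrtr_sqr ler_wsqrtr.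
rewrite /enorm -/A -/B.
rewrite -[leRHS]ger0_norm ?addr_ge0// -sqrtr_sqr ler_wsqrtr// sqrrD !sqr_sqrtr//.
rewrite (eq_bigr (fun i => x ord0 i ^+ 2 + (2 * (x ord0 i * y ord0 i) +
    y ord0 i ^+ 2))); last by move=> i _; rewrite mxE; lra.
by rewrite big_split/= big_split/= -mulr_sumr -/A -/B -/C; lra.
Qed.

Lemma measurable_enorm :
  measurable_fun [set: borel_rV R n] (fun x : borel_rV R n => enorm x).
Proof.
have msqrt : measurable_fun [set: R] (@Num.sqrt R).
  by apply: nondecreasing_measurable => // a b ab; exact: ler_wsqrtr.
apply: (measurableT_comp msqrt).
apply: measurable_sum => i; apply: measurable_funX.
exact: measurable_coord_rV.
Qed.

Lemma measurable_eball r : measurable (eball r : set (borel_rV R n)).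
Proof.
rewrite (_ : eball r = (fun x : borel_rV R n => enorm x) @^-1` `]-oo, r[%classic).
  by rewrite -[X in measurable X]setTI; exact: measurable_enorm.
by apply/seteqP; split => x; rewrite /eball/= in_itv.
Qed.

End euclidean_norm.

Section completion.
Context {R : realType} {n : nat}.

Lemma measurable_lebesgue_rV (A : set (borel_rV R n)) :
  measurable A -> measurable (A : set (lebesgue_type R n)).
Proof.
move=> mA.
exact: (@caratheodory_measurable_mu_ext _ _ _ (lebesgue_borel R n)).
Qed.

Lemma lebesgue_rVE (A : set (borel_rV R n)) :
  measurable A -> lebesgue_rV A = lebesgue_borel R n A.
Proof. by move=> mA; rewrite /lebesgue_rV /completed_measure_extension measurable_mu_extE. Qed.

Lemma measurable_fun_lebesgue_rV d (T : measurableType d) (f : borel_rV R n -> T) :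
  measurable_fun setT f -> measurable_fun setT (f : lebesgue_type R n -> T).
Proof.
move=> mf _ Y mY; rewrite setTI; apply: measurable_lebesgue_rV.
by rewrite -[X in measurable X]setTI; exact: mf.
Qed.

(** The completed measure extends the Borel one, so Borel integrands may be handled with
    [lebesgue_borel], to which Tonelli's theorem applies. *)
Lemma integral_lebesgue_rV (f : borel_rV R n -> \bar R) :
  measurable_fun setT f -> (forall x, 0 <= f x)%E ->
  (\int[@lebesgue_rV R n]_x f x = \int[lebesgue_borel R n]_x f x)%E.
Proof.
move=> mf f0.
rewrite -[LHS]mul1e.
apply: (@ge0_integral_comp_scaled _ _ _ _ _ (@lebesgue_rV R n)
  (lebesgue_borel R n) (fun x => x) 1).
- exact: (@measurable_fun_lebesgue_rV _ _ (fun x => x)).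
- exact: ler01.
- by move=> A mA; rewrite mul1e; exact: lebesgue_rVE.
- exact: mf.
- exact: f0.
Qed.


End completion.

(** * Norms and interior cones *)

Section norm_comparison.
Context {R : realType} {n : nat} (N : 'rV[R]_n -> R) (hN : is_norm N).

Lemma is_norm0 : N 0 = 0.
Proof. by have [_ NZ _] := hN; rewrite -(scale0r (0 : 'rV[R]_n)) NZ normr0 mul0r. Qed.

Lemma is_normN x : N (- x) = N x.
Proof. by have [_ NZ _] := hN; rewrite -scaleN1r NZ normrN1 mul1r. Qed.

Lemma is_norm_ge0 x : 0 <= N x.
Proof.
have [_ _ ND] := hN; have := ND x (- x).
by rewrite subrr is_norm0 is_normN -mulr2n pmulrn_lge0.
Qed.

Lemma is_norm_le_norm : exists C : R, 0 < C /\ forall x, N x <= C * `|x|.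
Proof.
have [_ NZ ND] := hN.
exists (1 + \sum_(i < n) N (delta_mx ord0 i)); split.
  by rewrite ltr_pwDl// sumr_ge0// => i _; exact: is_norm_ge0.
move=> x; rewrite mulrDl mul1r -[leLHS]add0r lerD//.
rewrite {1}(row_sum_delta x) mulr_suml.
elim/big_ind2 : _ => [|a b c e ab ce|i _].
- by rewrite is_norm0.
- by apply: le_trans (ND _ _) _; exact: lerD.
- by rewrite NZ mulrC ler_wpM2l ?is_norm_ge0// coord_rV_le_norm.
Qed.

Lemma is_norm_continuous : continuous N.
Proof.
have [_ NZ ND] := hN; have [C [C0 NC]] := is_norm_le_norm.
move=> x; apply/(@cvgrPdist_le _ _ _ (nbhs x) (nbhs_filter x)) => e e0.
have eC0 : 0 < e / C by rewrite divr_gt0.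
apply: filterS (nbhsx_ballx x (e / C) eC0) => y; rewrite -ball_normE /ball_/= => xy.
have Nxy : N (x - y) <= e.
  by apply: le_trans (NC _) _; rewrite -ler_pdivlMl// mulrC ltW.
rewrite ler_norml; apply/andP; split.
  have := ND (y - x) x; rewrite subrK -(opprB x y) is_normN; lra.
by have := ND (x - y) y; rewrite subrK; lra.
Qed.

(** [N] attains its minimum on the compact unit sphere of the sup norm, and this minimum is positive
    since [N] vanishes only at 0. *)
Lemma norm_le_is_norm : exists c : R, 0 < c /\ forall x, c * `|x| <= N x.
Proof.
have [N0 NZ ND] := hN.
pose S := [set x : 'rV[R]_n | `|x| = 1].
have [S0|] := pselect (S !=set0); last first.
  (* If the sphere is empty, every vector is 0 and any constant works. *)
  move=> S0; exists 1; split => // x; rewrite mul1r.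
  have [->|x0] := eqVneq x 0; first by rewrite normr0 is_norm_ge0.
  exfalso; apply: S0; exists (`|x|^-1 *: x).
  by rewrite /S/= normrZ normfV normr_id mulVf// normr_eq0.
have cS : compact S.
  apply: bounded_closed_compact.
    by exists 1; split => // M M1 x /= ->; exact: ltW.
  have -> : S = (fun x : 'rV[R]_n => `|x|) @^-1` [set 1] by [].
  by apply: closed_comp => [x _|]; [exact: norm_continuous|exact: closed_eq].
have [x Sx xmin] := compact_EVT_min S0 cS (continuous_subspaceT is_norm_continuous).
have Nx0 : 0 < N x.
  rewrite lt_neqAle is_norm_ge0 andbT eq_sym; apply/eqP => /N0 x0.
  by move: Sx; rewrite inE /S/= x0 normr0 => /eqP; rewrite eq_sym oner_eq0.
exists (N x); split => // y; have [->|y0] := eqVneq y 0.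
  by rewrite normr0 mulr0 is_norm_ge0.
have y0' : 0 < `|y| by rewrite normr_gt0.
have := xmin (`|y|^-1 *: y).
rewrite inE /S/= normrZ normfV normr_id mulVf ?gt_eqF// => /(_ erefl).
by rewrite NZ normfV normr_id ler_pdivlMl// mulrC.
Qed.

End norm_comparison.

Section interior_cone.
Context {R : realType} {n : nat}.

Lemma mulmx_norm_le (Q : 'M[R]_n) : exists M : R, 0 < M /\
  forall v : 'rV[R]_n, `|v *m Q| <= M * `|v|.
Proof.
exists (1 + \sum_(i < n) \sum_(j < n) `|Q i j|); split.
  by rewrite ltr_pwDl// sumr_ge0// => i _; rewrite sumr_ge0.
move=> v; apply/norm_rV_le => [|j].
  by rewrite mulr_ge0// addr_ge0// sumr_ge0// => i _; rewrite sumr_ge0.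
rewrite mulrDl mul1r -[leLHS]add0r lerD// mxE (le_trans (ler_norm_sum _ _ _))//.
rewrite mulr_suml; apply: ler_sum => i _; rewrite normrM mulrC.
rewrite ler_pM ?coord_rV_le_norm// (bigD1 j)//= lerDl.
by rewrite sumr_ge0.
Qed.

Lemma norm_col'_le i (v : 'rV[R]_n) : `|col' i v| <= `|v|.
Proof.
by apply/norm_rV_le => // j; rewrite mxE; exact: coord_rV_le_norm.
Qed.

(** In the graph coordinates, a direction close to the [i]-th axis climbs faster than the Lipschitz
    graph can rise. A single [r] bounds the neighbourhood of [x0], the aperture of the cone and its
    height. *)
Lemma lipschitz_boundary_cone_at (Omega : set 'rV[R]_n) (x0 : 'rV[R]_n) :
  open Omega -> lipschitz_boundary Omega -> closure Omega x0 ->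
  exists (r : R) (e : 'rV[R]_n), 0 < r /\ forall x w t,
    Omega x -> ball x0 r x -> ball e r w -> 0 <= t -> t <= r -> Omega (x + t *: w).
Proof.
move=> oO lO cx0.
have [Ox0|nOx0] := pselect (Omega x0).
  have /nbhs_ballP[s /= s0 sO] : nbhs x0 Omega by exact: open_nbhs_nbhs.
  (* Interior point: short moves in any direction stay in a ball inside [Omega], so the axis may be
     0. *)
  pose r := Num.min 1 (s / 2).
  have r0 : 0 < r by rewrite lt_min ltr01 divr_gt0.
  have r1 : r <= 1 by rewrite ge_min lexx.
  have rs : r <= s / 2 by rewrite ge_min lexx orbT.
  exists r, 0; split => // x w t _; rewrite -!ball_normE /ball_/= sub0r normrN => x0x wr t0 tr.
  apply: sO; rewrite -ball_normE /ball_/= opprD addrA.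
  apply: le_lt_trans (ler_normB _ _) _.
  rewrite normrZ (ger0_norm t0).
  have : t * `|w| <= r * 1 by rewrite ler_pM// (le_trans (ltW wr)).
  lra.
have /lO : (closure Omega `\` Omega^°) x0.
  by split => //; rewrite (interior_id _).1.
move=> [r0 [Q [i [g [r00 QQ [L0 [_ gL0]] OE]]]]].
(* The Lipschitz bound holds for every constant above [L0]; the maximum with 0 makes [L]
   nonnegative. *)
pose L := Num.max 0 (L0 + 1).
have L_ge0 : 0 <= L by rewrite le_max lexx.
have gL x y : `|g x - g y| <= L * `|x - y|.
  apply: le_trans (gL0 (L0 + 1) _ (x, y) _) _ => //=; first by rewrite ltrDl.
  by rewrite ler_wpM2r// le_max lexx orbT.
(* The [i]-th axis of the graph coordinates, read in the original ones. *)
pose e : 'rV[R]_n := delta_mx ord0 i *m Q^T.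
have eQ : e *m Q = delta_mx ord0 i.
  by rewrite /e -mulmxA (mulmx1C QQ) mulmx1.
have [M [M0 QM]] := mulmx_norm_le Q.
pose A := n%:R * (2 + `|e|).
have A0 : 0 <= A by rewrite mulr_ge0// addr_ge0.
(* The second bound lets the climb [t] beat the error [t * r * M * (L + 1)] due to the aperture; the
   third keeps the points, before and after the move, within Euclidean distance [r0] of [x0], where
   the graph describes [Omega]. *)
pose r := Num.min 1 (Num.min (M * (L + 1))^-1 (r0 / (A + 1))).
have ML : 0 < M * (L + 1) by rewrite mulr_gt0// ltr_wpDl.
have A1 : 0 < A + 1 by rewrite ltr_wpDl.
have rgt0 : 0 < r by rewrite !lt_min ltr01 invr_gt0 ML divr_gt0.
have r1 : r <= 1 by rewrite ge_min lexx.
have rM : r * (M * (L + 1)) <= 1.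
  by rewrite -ler_pdivlMr// mul1r !ge_min lexx !orbT.
have rA : r * (A + 1) <= r0.
  by rewrite -ler_pdivlMr// !ge_min lexx !orbT.
exists r, e; split => // x w t Ox; rewrite -!ball_normE /ball_/= => x0x ew t_ge0 tr.
have small (y : 'rV[R]_n) : `|x0 - y| <= r * (2 + `|e|) -> enorm (y - x0) < r0.
  move=> H; apply: le_lt_trans (enorm_le_norm _) _.
  rewrite distrC; apply: le_lt_trans (ler_wpM2l _ H) _ => //.
  apply: lt_le_trans rA; rewrite mulrCA -/A; lra.
have w_le : `|w| <= `|e| + 1.
  have := ler_normB e (e - w); rewrite opprB addrC subrK; lra.
have Hx : enorm (x - x0) < r0.
  apply: small; apply: le_trans (ltW x0x) _; rewrite -[leLHS]mulr1 ler_wpM2l ?(ltW rgt0)//.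
  by have := normr_ge0 e; lra.
have gx := (OE x Hx).1 Ox.
have Hxw : enorm (x + t *: w - x0) < r0.
  apply: small; rewrite opprD addrA; apply: le_trans (ler_normB _ _) _.
  rewrite normrZ (ger0_norm t_ge0).
  have : t * `|w| <= r * (`|e| + 1) by rewrite ler_pM.
  lra.
apply/(OE _ Hxw).
set v := (w - e) *m Q.
have vr : `|v| <= r * M.
  apply: le_trans (QM _) _; rewrite mulrC ler_wpM2r// ?(ltW M0)//.
  by rewrite distrC ltW.
have wQ : w *m Q = delta_mx ord0 i + v by rewrite /v mulmxBl eQ addrC subrK.
have -> : (x + t *: w) *m Q = x *m Q + t *: delta_mx ord0 i + t *: v.
  by rewrite mulmxDl -scalemxAl wQ scalerDr addrA.
have c0 : col' i (x *m Q + t *: delta_mx ord0 i + t *: v) = col' i (x *m Q) + t *: col' i v.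
  apply/rowP => j; rewrite !mxE eqxx/= (_ : (lift i j == i) = false) ?mulr0 ?addr0//.
  by apply/negbTE; rewrite eq_sym neq_lift.
rewrite c0 !mxE !eqxx mulr1.
have := gL (col' i (x *m Q) + t *: col' i v) (col' i (x *m Q)).
rewrite [X in _ * `|X|]addrAC subrr add0r normrZ (ger0_norm t_ge0) => /ler_normlW.
have : L * (t * `|col' i v|) <= L * (t * (r * M)).
  by rewrite !ler_wpM2l// (le_trans (norm_col'_le _ _)).
have : - (r * M) <= v ord0 i.
  by have := le_trans (coord_rV_le_norm v i) vr; rewrite ler_norml => /andP[].
move=> h1 h2 h3.
have : t * (- (r * M)) <= t * v ord0 i by rewrite ler_wpM2l.
have : t * (r * (M * (L + 1))) <= t * 1 by rewrite ler_wpM2l.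
move: gx; rewrite !mxE => gx h4 h5.
lra.
Qed.

End interior_cone.

Lemma seq_min_gt0 (R : realType) (T : eqType) (s : seq T) (f : T -> R) :
  (forall x, x \in s -> 0 < f x) ->
  exists h : R, 0 < h /\ forall x, x \in s -> h <= f x.
Proof.
elim: s => [|a s IH] H; first by exists 1; split.
have [x xs|h [h0 hs]] := IH; first by apply: H; rewrite inE xs orbT.
exists (Num.min h (f a)); split; first by rewrite lt_min h0 H ?mem_head.
move=> x; rewrite inE => /predU1P[->|/hs hx]; first by rewrite ge_min lexx orbT.
by rewrite ge_min hx.
Qed.

(** Compactness of the closure leaves finitely many of the local cones; [h] lies below all their
    sizes and [M] bounds all admissible directions. *)
Lemma lipschitz_boundary_cone (R : realType) (n : nat) (Omega : set 'rV[R]_n) :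
  bounded_set Omega -> open Omega -> lipschitz_boundary Omega ->
  exists (s : seq 'rV[R]_n) (r : 'rV[R]_n -> R) (e : 'rV[R]_n -> 'rV[R]_n) (h M : R),
  [/\ 0 < h, 0 < M,
    forall x, Omega x -> exists2 p, p \in s & ball p (r p) x,
    forall p w, p \in s -> ball (e p) h w -> `|w| < M &
    forall p x w t, p \in s -> Omega x -> ball p (r p) x -> ball (e p) h w ->
      0 <= t -> t <= h -> Omega (x + t *: w)].
Proof.
move=> [B [Breal bO]] oO lO.
have cO : compact (closure Omega).
  apply: bounded_closed_compact; last exact: closed_closure.
  have cB : closed [set x : 'rV[R]_n | `|x| <= B + 1].
    have -> : [set x : 'rV[R]_n | `|x| <= B + 1] =
        (fun x : 'rV[R]_n => `|x|) @^-1` [set y | y <= B + 1] by [].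
    by apply: closed_comp => [x _|]; [exact: norm_continuous|exact: closed_le].
  exists (B + 1); split; first by rewrite num_real.
  move=> M /ltW BM x cx; apply: le_trans BM.
  move: x cx; apply: (subset_trans (@closureS _ _ [set x : 'rV[R]_n | `|x| <= B + 1] _)).
    by move=> x Ox; apply: (bO (B + 1)); rewrite ?ltrDl.
  by rewrite -(closure_id _).1.
(* Points off the closure receive the dummy value [(1, 0)], as the choice runs over the whole
   space. *)
have /choice[re reP] : forall p : 'rV[R]_n, exists re : R * 'rV[R]_n,
    0 < re.1 /\ (closure Omega p -> forall x w t, Omega x -> ball p re.1 x ->
      ball re.2 re.1 w -> 0 <= t -> t <= re.1 -> Omega (x + t *: w)).
  move=> p; have [cp|ncp] := pselect (closure Omega p); last by exists (1, 0).
  by have [r [e [r0 H]]] := lipschitz_boundary_cone_at _ _ oO lO cp; exists (r, e).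
move: cO; rewrite compact_cover => /(_ _ (closure Omega) (fun p => ball p (re p).1)).
case.
- by move=> p _; exact: ball_open.
- by move=> x cx; exists x => //; apply: ballxx; exact: (reP x).1.
move=> D Dc Ocov.
pose s : seq 'rV[R]_n := finmap.enum_fset D.
have [h [h0 hD]] : exists h : R, 0 < h /\ forall p, p \in s -> h <= (re p).1.
  by apply: seq_min_gt0 => p _; exact: (reP p).1.
exists s, (fun p => (re p).1), (fun p => (re p).2), h,
  (h + \sum_(p <- s) `|(re p).2|).
split => //.
- by rewrite ltr_pwDl// sumr_ge0.
- move=> x Ox; have [p Dp px] := Ocov x (subset_closure Ox); by exists p.
- move=> p w pD; rewrite -ball_normE /ball_/= => pw.
  have : `|(re p).2| <= \sum_(p <- s) `|(re p).2|.
    by rewrite (big_rem p pD)/= lerDl sumr_ge0.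
  have := ler_normB (re p).2 ((re p).2 - w); rewrite opprB addrC subrK; lra.
- move=> p x w t pD Ox xp wp t0 th; have hp := hD p pD.
  apply: (reP p).2 => //.
  + by have := Dc p pD; rewrite inE.
  + by apply: le_ball wp.
  + exact: le_trans hp.
Qed.

(** * Crossing energy at a fixed scale *)

Section product_sections.
Context d1 d2 (T1 : measurableType d1) (T2 : measurableType d2) (R : realType).
Variables (m1 : {sigma_finite_measure set T1 -> \bar R})
  (m2 : {sigma_finite_measure set T2 -> \bar R}).

Lemma product_measure_xsection (S : set (T1 * T2)) :
  ((m1 \x m2) S = \int[m1]_x m2 (xsection S x))%E.
Proof. by []. Qed.

Lemma product_measure_ysection (S : set (T1 * T2)) : measurable S ->
  ((m1 \x m2) S = \int[m2]_y m1 (ysection S y))%E.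
Proof.
move=> mS; rewrite product_measure_xsection.
have := indic_fubini_tonelli m1 m2 mS.
by rewrite indic_fubini_tonelli_FE// indic_fubini_tonelli_GE.
Qed.

End product_sections.

Section crossing.
Context {R : realType} {n : nat}.
Local Notation X := (borel_rV R n).
Local Notation beta := (lebesgue_borel R n).

(* The double integral of [\1_B y * \1_A x] over the pairs with [|x - y| < s]. *)
Definition crossing (A B : set X) (s : R) : \bar R :=
  (\int[beta]_(y in B) beta (A `&` ball (y : 'rV[R]_n) s))%E.

Lemma measurable_scaler_add (t : R) : measurable_fun [set: X * X]
  (fun p : X * X => (p.2 : 'rV[R]_n) + t *: (p.1 : 'rV[R]_n) : X).
Proof.
apply: measurable_fun_rV => i.
rewrite (_ : _ \o _ = fun p : X * X => @coord_rV R n i p.2 + t * @coord_rV R n i p.1); last first.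
  by apply/funext => p; rewrite /coord_rV/= !mxE.
have m1 := measurableT_comp (measurable_coord_rV i) (@measurable_fst _ _ X X).
have m2 := measurableT_comp (measurable_coord_rV i) (@measurable_snd _ _ X X).
by apply: measurable_funD => //; exact: measurable_funM.
Qed.

Lemma lebesgue_borel_translate (v : 'rV[R]_n) (A : set X) : measurable A ->
  beta [set x | A ((x : 'rV[R]_n) + v)] = beta A.
Proof.
move=> mA; rewrite -[RHS](@lebesgue_borel_affine R n 1 v A)// expr1n mul1e.
by congr (lebesgue_borel R n _); apply/seteqP; split => x /=; rewrite scale1r.
Qed.

(* [SJ] and [SI] are the pairs (w, x) for which x + T w stays in [E], resp. leaves
   it. [small] makes [SJ] at most half of everything; each pair in [SI] leaves [E]
   at one of the [k] steps of the chain x, x + tau w, ..., x + k tau w, whence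
   pi SI <= k * pi SK by translation invariance. *)
Lemma crossing_lower (Omega E V : set X) (e : 'rV[R]_n) (h M T : R) (k : nat) :
  measurable Omega -> measurable E -> measurable V -> E `<=` Omega -> V `<=` E ->
  (beta E < +oo)%E -> 0 < h -> 0 < T -> T <= h -> (0 < k)%N ->
  (forall w, ball e h w -> `|w| < M) ->
  (forall x w t, V x -> ball e h w -> 0 <= t -> t <= h -> Omega (x + t *: w)) ->
  (2%:E * beta E <= (T ^+ n)%:E * ((2 * h) ^+ n)%:E)%E ->
  (((T / k%:R) ^+ n)%:E * ((2 * h) ^+ n)%:E * beta V <=
    (2 * k%:R)%:E * crossing (Omega `\` E) E (T / k%:R * M))%E.
Proof.
move=> mO mE mV EO VE Efin h0 T0 Th k0 eM cone small.
set tau := T / k%:R; set a := (2 * h) ^+ n.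
have k0' : 0 < k%:R :> R by rewrite ltr0n.
have tau0 : 0 < tau by rewrite divr_gt0.
have a0 : 0 < a by rewrite exprn_gt0// mulr_gt0.
pose A : set X := ball e h.
have mA : measurable A by exact: measurable_ball_rV.
have aE : beta A = a%:E by exact: lebesgue_borel_ball.
have Vfin : (beta V < +oo)%E.
  by apply: le_lt_trans Efin; apply: le_measure; rewrite ?inE.
pose pi := (beta \x beta)%E.
pose SJ := [set p : X * X | [/\ A p.1, V p.2 & E (p.2 + T *: p.1)]].
pose SI := [set p : X * X | [/\ A p.1, V p.2 & ~ E (p.2 + T *: p.1)]].
pose SK := [set p : X * X | [/\ A p.1, E p.2 & (Omega `\` E) (p.2 + tau *: p.1)]].
have mpre (B : set X) (t : R) : measurable B ->
    measurable [set p : X * X | B (p.2 + t *: p.1)].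
  by move=> mB; rewrite -[X in measurable X]setTI; exact: measurable_scaler_add.
have mfst (B : set X) : measurable B -> measurable [set p : X * X | B p.1].
  by move=> mB; rewrite -[X in measurable X]setTI; exact: measurable_fst.
have msnd (B : set X) : measurable B -> measurable [set p : X * X | B p.2].
  by move=> mB; rewrite -[X in measurable X]setTI; exact: measurable_snd.
have mI3 (P1 P2 P3 : set (X * X)) : measurable P1 -> measurable P2 ->
    measurable P3 -> measurable [set p | [/\ P1 p, P2 p & P3 p]].
  move=> mP1 mP2 mP3.
  rewrite (_ : [set p | _] = P1 `&` P2 `&` P3).
    by apply: measurableI => //; exact: measurableI.
  by apply/seteqP; split => p /=; [case=> ? ? ?; do !split|case=> -[? ?] ?; split].
have mSJ : measurable SJ.
  exact: (mI3 [set p | A p.1] [set p | V p.2] _ (mfst _ mA) (msnd _ mV) (mpre _ T mE)).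
have mSI : measurable SI.
  exact: (mI3 [set p | A p.1] [set p | V p.2] _ (mfst _ mA) (msnd _ mV)
    (mpre _ T (measurableC mE))).
have mSK : measurable SK.
  exact: (mI3 [set p | A p.1] [set p | E p.2] _ (mfst _ mA) (msnd _ mE)
    (mpre _ tau (measurableD mO mE))).
have piAV : (a%:E * beta V = pi SI + pi SJ)%E.
  rewrite -aE -product_measure1E// -measureU//.
    congr (_ _); apply/seteqP; split => -[w x] /=.
      by move=> [Aw Vx]; have [|] := pselect (E (x + T *: w)); [right|left].
    by case=> -[].
  by apply/seteqP; split => // -[w x] /= [[_ _ H1] [_ _ H2]].
(* For fixed [x], the map from [w] to [x + T w] has Jacobian [T ^+ n], so the section of [SJ] at [x]
   has measure at most that of [E] divided by [T ^+ n]. *)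
have piJ : ((T ^+ n)%:E * pi SJ <= beta V * beta E)%E.
  rewrite /pi product_measure_ysection// -ge0_integralZl//; last 2 first.
  - exact: measurable_fun_ysection.
  - by rewrite lee_fin exprn_ge0// ltW.
  rewrite -[leRHS]muleC -integral_cst// [leRHS]integral_mkcond.
  apply: le_ge0_integral => x _; first by rewrite mule_ge0// lee_fin exprn_ge0// ltW.
  rewrite /patch; case: ifPn => [Vx|nVx].
    rewrite -(@lebesgue_borel_affine R n T x E)//.
    rewrite lee_pmul2l// ?lte_fin ?exprn_gt0//.
    apply: le_measure; rewrite ?inE//; first exact: measurable_ysection.
      by rewrite -[X in measurable X]setTI; exact: measurable_affine_rV.
    by move=> w; rewrite /ysection/= inE => -[_ _]; rewrite addrC.
  rewrite (_ : ysection SJ x = set0) ?measure0 ?mule0//.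
  apply/seteqP; split => // w; rewrite /ysection/= inE => -[_ Vx].
  by move: nVx; rewrite notin_setE.
have piI : (pi SI <= k%:R%:E * pi SK)%E.
  rewrite /pi !product_measure_xsection -ge0_integralZl//; last first.
    exact: measurable_fun_xsection.
  apply: le_ge0_integral => // w _.
  have [Aw|nAw] := pselect (A w); last first.
    rewrite (_ : xsection SI w = set0) ?measure0 ?mule_ge0//.
    by apply/seteqP; split => // x; rewrite /xsection/= inE => -[].
  (* A point outside [E] after [j + 1] steps was already outside after [j] steps, or leaves [E] at
     this very step and is counted, up to a translation, in the section of [SK] at [w]. *)
  have chain j : (j <= k)%N ->
      (beta [set x : X | V x /\ ~ E ((x : 'rV[R]_n) + (j%:R * tau) *: w)%R] <= j%:R%:E * beta (xsection SK w))%E.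
    have mW (t : R) : measurable [set x : X | V x /\ ~ E (x + t *: w)].
      rewrite (_ : [set x | _] = V `&` ((fun x : X => 1 *: (x:'rV[R]_n) + t *: w : X) @^-1` (~` E))).
        apply: measurableI => //.
        rewrite -[X in measurable X]setTI; apply: measurable_affine_rV => //.
        exact: measurableC.
      by apply/seteqP; split => x /=; rewrite scale1r.
    elim: j => [_|j IH jk].
      rewrite mul0e (_ : [set x | _] = set0) ?measure0//.
      by apply/seteqP; split => // x /=; rewrite mul0r scale0r addr0 => -[/VE].
    rewrite -natr1 EFinD ge0_muleDl// mul1e.
    have mSKw : measurable (xsection SK w) by exact: measurable_xsection.
    rewrite -[X in (_ <= _ + X)%E](lebesgue_borel_translate ((j%:R * tau) *: w))//.
    have mtr : measurable [set x : X | xsection SK w ((x : 'rV[R]_n) + (j%:R * tau) *: w)].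
      rewrite (_ : [set x | _] = (fun x : X => 1 *: (x:'rV[R]_n) + (j%:R * tau) *: w : X) @^-1` (xsection SK w)).
        by rewrite -[X in measurable X]setTI; apply: measurable_affine_rV.
      by apply/seteqP; split => x /=; rewrite scale1r.
    apply: (@le_trans _ _ (beta ([set x : X | V x /\ ~ E ((x : 'rV[R]_n) + (j%:R * tau) *: w)%R] `|`
      [set x : X | xsection SK w ((x : 'rV[R]_n) + (j%:R * tau) *: w)%R]))).
      apply: le_measure; rewrite ?inE//; first exact: measurableU.
      move=> x /= [Vx nE]; have [Ej|nEj] := pselect (E (x + (j%:R * tau) *: w)).
        right; rewrite /xsection/= inE; split => //=.
        rewrite -addrA -scalerDl (_ : _ + tau = j.+1%:R * tau); last first.
          by rewrite -natr1 mulrDl mul1r.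
        split; last by rewrite -natr1.
        apply: cone => //; first by rewrite mulr_ge0// ltW.
        apply: le_trans Th; rewrite /tau mulrCA -[leRHS]mulr1 ler_wpM2l ?(ltW T0)//.
        by rewrite ler_pdivrMr// mul1r ler_nat.
      by left.
    apply: le_trans (measureU2 _ _ _) _ => //.
    by rewrite leeD2r// IH// ltnW.
  have := chain k (leqnn k); apply: le_trans.
  rewrite (_ : xsection SI w = [set x : X | V x /\ ~ E ((x : 'rV[R]_n) + (k%:R * tau) *: w)]) //.
  apply/seteqP; split => x; rewrite /xsection/= ?inE /tau mulrC divfK ?gt_eqF//; first by case.
  by move=> [? ?]; split.
(* For fixed [x], [x + tau w] is taken as the new variable; it lies within [tau * M] of [x] because
   [w] has norm below [M]. *)
have piK : ((tau ^+ n)%:E * pi SK <= crossing (Omega `\` E) E (tau * M))%E.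
  rewrite /pi product_measure_ysection// -ge0_integralZl//; last 2 first.
  - exact: measurable_fun_ysection.
  - by rewrite lee_fin exprn_ge0// ltW.
  rewrite /crossing [leRHS]integral_mkcond.
  apply: le_ge0_integral => x _; first by rewrite mule_ge0// lee_fin exprn_ge0// ltW.
  rewrite /patch; case: ifPn => [Ex|nEx].
    have mB : measurable ((Omega `\` E) `&` (ball (x : 'rV[R]_n) (tau * M) : set X)).
      by apply: measurableI; [exact: measurableD|exact: measurable_ball_rV].
    rewrite -(@lebesgue_borel_affine R n tau x _)//.
    rewrite lee_pmul2l// ?lte_fin ?exprn_gt0//.
    apply: le_measure; rewrite ?inE//; first exact: measurable_ysection.
      by rewrite -[X in measurable X]setTI; exact: measurable_affine_rV.
    move=> w; rewrite /ysection/= inE => -[/= Aw _]; rewrite addrC => ?; split => //.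
    rewrite -ball_normE /ball_/= opprD addrC subrK normrN normrZ gtr0_norm//.
    by rewrite ltr_pM2l//; exact: eM.
  rewrite (_ : ysection SK x = set0) ?measure0 ?mule0//.
  apply/seteqP; split => // w; rewrite /ysection/= inE => -[_ /= Ex].
  by move: nEx; rewrite notin_setE.
have bV : beta V = (fine (beta V))%:E by rewrite fineK// ge0_fin_numE.
have bE : beta E = (fine (beta E))%:E by rewrite fineK// ge0_fin_numE.
have fSI : (pi SI < +oo)%E.
  rewrite (@le_lt_trans _ _ (a%:E * beta V)%E)//; first by rewrite piAV leeDl.
  by rewrite bV -EFinM ltry.
have fSJ : (pi SJ < +oo)%E.
  rewrite (@le_lt_trans _ _ (a%:E * beta V)%E)//; first by rewrite piAV leeDr.
  by rewrite bV -EFinM ltry.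
have SIE : pi SI = (fine (pi SI))%:E by rewrite fineK// ge0_fin_numE.
have SJE : pi SJ = (fine (pi SJ))%:E by rewrite fineK// ge0_fin_numE.
have v0 : 0 <= fine (beta V) by rewrite fine_ge0.
have aV : (a%:E * beta V <= 2%:E * pi SI)%E.
  move: piAV piJ small; rewrite SIE SJE bV bE -!EFinM -EFinD !lee_fin -/a => -[piAV'].
  set v := fine (beta V); set c := fine (beta E); set i := fine (pi SI); set j := fine (pi SJ).
  rewrite -/v -/i -/j in piAV' v0 *.
  move=> piJ' small'.
  have Tn : 0 < T ^+ n by rewrite exprn_gt0.
  have : v * (2 * c) <= v * (T ^+ n * a) by rewrite ler_wpM2l.
  have -> : v * (T ^+ n * a) = T ^+ n * (v * a) by rewrite mulrCA.
  move=> H; have : T ^+ n * (2 * j) <= T ^+ n * (v * a) by lra.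
  by rewrite ler_pM2l//; lra.
rewrite -muleA; apply: (@le_trans _ _ ((tau ^+ n)%:E * (2%:E * (k%:R%:E * pi SK)))%E).
  rewrite lee_pmul2l ?lte_fin ?exprn_gt0//; apply: le_trans aV _.
  by rewrite lee_pmul2l.
rewrite muleCA (muleCA (_ ^+ _)%:E) muleA -EFinM lee_pmul2l//.
by rewrite lte_fin mulr_gt0.
Qed.

End crossing.

(** Once the part of [E] in the first set is removed, the rest is covered by the remaining sets. *)
Lemma measure_cover_seq d (T : measurableType d) (R : realType)
    (mu : {measure set T -> \bar R}) (I : eqType) (s : seq I) (B : I -> set T)
    (E : set T) (c : \bar R) :
  measurable E -> (forall i, measurable (B i)) ->
  (forall x, E x -> exists2 i, i \in s & B i x) ->
  (forall i, i \in s -> mu (E `&` B i) <= c)%E ->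
  (mu E <= (size s)%:R%:E * c)%E.
Proof.
move=> mE mB; elim: s E mE => [|i s IH] E mE cov Hc.
  rewrite mul0e (_ : E = set0) ?measure0//.
  by apply/seteqP; split => // x /cov[].
have c0 : (0 <= c)%E by apply: le_trans (Hc i (mem_head _ _)).
rewrite -(setDUK (@subIsetl _ E (B i))) -/(size _) /=.
rewrite -natr1 EFinD ge0_muleDl// mul1e addeC.
apply: le_trans (measureU2 _ _ _) _; [exact: measurableI|apply: measurableD => //; exact: measurableI|].
rewrite leeD ?Hc ?mem_head//; apply: IH => //.
- by apply: measurableD => //; exact: measurableI.
- move=> x [Ex nB]; have [j] := cov x Ex; rewrite inE => /predU1P[->|js] Bj.
    by exfalso; apply: nB.
  by exists j.
- move=> j js; apply: le_trans (Hc j _); last by rewrite inE js orbT.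
  apply: le_measure; rewrite ?inE; [|exact: measurableI|by move=> x [[]]].
  by apply: measurableI => //; apply: measurableD => //; exact: measurableI.
Qed.

Section relative_crossing.
Context {R : realType} {n : nat}.
Local Notation X := (borel_rV R n).
Local Notation beta := (lebesgue_borel R n).

Lemma crossing_ge0 (A B : set X) s : (0 <= crossing A B s)%E.
Proof. by apply: integral_ge0 => y _. Qed.

(** The part of [E] in each ball of the cover is bounded by [crossing_lower], and these parts are
    added up. The number of steps is of order [1 + rho / s], which is where the factor
    [s / (s + rho)] comes from. *)
Lemma lipschitz_crossing_lower (Omega : set 'rV[R]_n) : (0 < n)%N ->
  bounded_set Omega -> open Omega -> lipschitz_boundary Omega ->
  exists c s0 rho0 : R, [/\ 0 < c, 0 < s0, 0 < rho0 &
    forall (E : set X) (rho s : R), measurable E -> E `<=` Omega ->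
      0 < rho -> rho <= rho0 -> 0 < s -> s <= s0 -> beta E = (rho ^+ n)%:E ->
      ((c * (s ^+ n * rho ^+ n * (s / (s + rho))))%:E <=
       crossing (Omega `\` E) E s)%E].
Proof.
move=> n0 bO oO lO.
have [ps [r [e [h [M [h0 M0 cov eM cone]]]]]] := @lipschitz_boundary_cone _ _ _ bO oO lO.
pose C1 := 1 + M / h.
have C10 : 0 < C1 by rewrite ltr_wpDr// divr_ge0// ltW.
(* One more than the number of balls, so as to be positive even for an empty cover. *)
pose l : R := (size ps).+1%:R.
have l0 : 0 < l by [].
pose c := (2 * h / M) ^+ n / (2 * l * C1).
have c0 : 0 < c by rewrite divr_gt0// ?exprn_gt0 ?mulr_gt0 ?invr_gt0.
(* These thresholds make both [s / M] and [rho / h] at most [h / 2], whence [T <= h] below. *)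
exists c, (h * M / 2), (h ^+ 2 / 2); split => //.
- by rewrite divr_gt0// mulr_gt0.
- by rewrite divr_gt0// exprn_gt0.
move=> E rho s mE EO rho_gt0 rho_le s_gt0 s_le bE.
have mO : measurable (Omega : set X) by exact: open_measurable_rV.
(* The least [T] with [T * h >= rho]; for such [T], the number [(2 * T * h) ^+ n] is at least
   [(2 * rho) ^+ n], hence at least twice the measure of [E]. *)
pose Tm := rho / h.
have Tm0 : 0 < Tm by rewrite divr_gt0.
have TmM : 0 <= Tm * M / s by rewrite ltW// divr_gt0// mulr_gt0.
pose k := (Num.truncn (Tm * M / s)).+1.
have k1 : Tm * M / s < k%:R by exact: truncnS_gt.
have k2 : k%:R <= 1 + Tm * M / s.
  by rewrite /k -natr1 addrC lerD2l; move: (truncn_itv TmM) => /andP[].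
have k0 : 0 < k%:R :> R by [].
(* [Tm] is rounded up to a multiple of [s / M], so that the scale [T / k * M] of [crossing_lower] is
   exactly [s]. *)
pose T := k%:R * (s / M).
have sM0 : 0 < s / M by rewrite divr_gt0.
have T0 : 0 < T by rewrite mulr_gt0.
have TmE : Tm * M / s * (s / M) = Tm.
  by rewrite -!mulrA mulKf ?divff ?mulr1// gt_eqF.
have TTm : Tm <= T.
  have : Tm * M / s * (s / M) <= k%:R * (s / M) by rewrite ler_wpM2r// ltW.
  by rewrite TmE.
have Th : T <= h.
  have : T <= (1 + Tm * M / s) * (s / M) by rewrite ler_wpM2r// ltW.
  rewrite mulrDl mul1r TmE => H.
  have : s / M <= h / 2 by rewrite ler_pdivrMr// mulrAC.
  have : Tm <= h / 2 by rewrite ler_pdivrMr// mulrAC -expr2.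
  lra.
have Tk : T / k%:R = s / M by rewrite /T mulrAC divff ?mul1r// gt_eqF.
have small : (2%:E * beta E <= (T ^+ n)%:E * ((2 * h) ^+ n)%:E)%E.
  rewrite bE -!EFinM lee_fin -exprMn.
  apply: (@le_trans _ _ ((2 * rho) ^+ n)).
    rewrite exprMn ler_wpM2r ?exprn_ge0 ?(ltW rho_gt0)//.
    by rewrite -[leLHS]expr1 ler_weXn2l// ler1n.
  have rho2 : 0 <= 2 * rho by rewrite mulr_ge0// ltW.
  have Th2 : 0 <= T * (2 * h) by apply/ltW/mulr_gt0 => //; exact: mulr_gt0.
  rewrite lerXn2r ?nnegrE//.
  have : Tm * h <= T * h by rewrite ler_wpM2r// ltW.
  rewrite /Tm divfK ?gt_eqF//; lra.
pose K := (s / M * (2 * h)) ^+ n.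
have K0 : 0 < K by rewrite exprn_gt0// !mulr_gt0 ?invr_gt0.
have step p : p \in ps -> (beta (E `&` (ball p (r p) : set X)) <=
    (2 * k%:R / K)%:E * crossing (Omega `\` E) E s)%E.
  move=> pps.
  have mV : measurable (E `&` (ball p (r p) : set X)).
    by apply: measurableI => //; exact: measurable_ball_rV.
  have Efin : (beta E < +oo)%E by rewrite bE ltry.
  have cone' x w t : (E `&` (ball p (r p) : set X)) x -> ball (e p) h w ->
      0 <= t -> t <= h -> Omega (x + t *: w).
    by move=> [Ex px]; apply: cone => //; exact: EO.
  have := @crossing_lower R n Omega E _ (e p) h M T k mO mE mV EO (@subIsetl _ _ _)
    Efin h0 T0 Th isT (fun w => eM p w pps) cone' small.
  rewrite Tk divfK ?gt_eqF// -EFinM -exprMn -/K => H.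
  by rewrite mulrC EFinM -muleA lee_pdivlMl.
have H : (beta E <= (size ps)%:R%:E * ((2 * k%:R / K)%:E * crossing (Omega `\` E) E s))%E.
  apply: (@measure_cover_seq _ _ _ beta _ ps (fun p => ball p (r p) : set X)) => //.
  - by move=> p; exact: measurable_ball_rV.
  - by move=> x /EO/cov.
rewrite bE in H.
have cr0 := crossing_ge0 (Omega `\` E) E s.
have srho : 0 < s + rho by rewrite addr_gt0.
have H2 : ((rho ^+ n)%:E <= (l * (2 * (C1 * ((s + rho) / s)) / K))%:E * crossing (Omega `\` E) E s)%E.
  apply: le_trans H _; rewrite muleA -EFinM lee_wpmul2r// lee_fin.
  rewrite ler_pM ?ler_nat//; first by rewrite mulr_ge0// ?invr_ge0 ltW// mulr_gt0.
  rewrite ler_wpM2r ?invr_ge0 ?(ltW K0)// ler_wpM2l//; apply: le_trans k2 _.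
  rewrite /C1 /Tm mulrDl mul1r mulrDl divff ?gt_eqF//.
  have -> : rho / h * M / s = M / h * (rho / s).
    by lra.
  rewrite !mulrDr mulr1.
  have : 0 <= rho / s by rewrite divr_ge0// ltW.
  have : 0 <= M / h by rewrite divr_ge0// ltW.
  lra.
have D0 : 0 < c * (s ^+ n * (s / (s + rho))).
  by rewrite mulr_gt0// mulr_gt0 ?exprn_gt0// divr_gt0.
have E1 : c * (s ^+ n * (s / (s + rho))) * (l * (2 * (C1 * ((s + rho) / s)) / K)) = 1.
  have KE : K = s ^+ n * (2 * h / M) ^+ n.
    by rewrite /K -exprMn; congr (_ ^+ n); lra.
  rewrite /c; set G := (2 * h / M) ^+ n in KE *; set Q := 2 * l * C1.
  have G0 : 0 < G by rewrite exprn_gt0// divr_gt0// mulr_gt0.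
  have Q0 : 0 < Q by rewrite !mulr_gt0.
  rewrite (_ : _ * _ = (s ^+ n * G / K) * ((s / (s + rho)) * ((s + rho) / s)) * (Q / Q)).
    rewrite -KE !divff ?gt_eqF// mul1r mulr1 -[(s + rho) / s]invf_div.
    by rewrite divff// gt_eqF// divr_gt0.
  rewrite {2}/Q.
  move: (s ^+ n) (K^-1) (Q^-1) ((s + rho) / s) (s / (s + rho)) => ? ? ? ? ?; lra.
rewrite (_ : c * _ = c * (s ^+ n * (s / (s + rho))) * rho ^+ n); last by lra.
rewrite EFinM; apply: le_trans (lee_wpmul2l _ H2) _; first by rewrite lee_fin ltW.
by rewrite muleA -EFinM E1 mul1e.
Qed.

End relative_crossing.

Lemma measurable_ltr d (T : measurableType d) (R : realType) (f g : T -> R) :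
  measurable_fun setT f -> measurable_fun setT g -> measurable [set x | f x < g x].
Proof.
move=> mf mg.
rewrite (_ : [set x | f x < g x] = (fun x => f x < g x) @^-1` [set true]).
  by rewrite -[X in measurable X]setTI; exact: measurable_fun_ltr.
by apply/seteqP; split => x.
Qed.

Lemma measurable_ball_rel d (T : measurableType d) (R : realType) (n : nat)
    (f g : T -> borel_rV R n) (phi : T -> R) :
  measurable_fun setT f -> measurable_fun setT g -> measurable_fun setT phi ->
  measurable [set z | ball (f z : 'rV[R]_n) (phi z) (g z : 'rV[R]_n)].
Proof.
move=> mf mg mphi.
have mh : measurable_fun setT (fun z => (f z : 'rV[R]_n) - (g z : 'rV[R]_n) : borel_rV R n).
  apply: measurable_fun_rV => i.
  rewrite (_ : _ \o _ = fun z => coord_rV i (f z) - coord_rV i (g z)); last first.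
    by apply/funext => z; rewrite /coord_rV/= !mxE.
  by apply: measurable_funB; exact: measurableT_comp (measurable_coord_rV i) _.
rewrite (_ : [set z | _] = [set z | `|(f z : 'rV[R]_n) - (g z : 'rV[R]_n)| < phi z]).
  apply: measurable_ltr => //.
  exact: measurableT_comp (@measurable_norm_rV R n) mh.
by apply/seteqP; split => z /=; rewrite -ball_normE.
Qed.

(** * Upper bound for the crossing energy of Euclidean balls *)

Section crossing_upper.
Context {R : realType} {n : nat}.
Local Notation X := (borel_rV R n).
Local Notation beta := (lebesgue_borel R n).

Definition crossing_set (A B : set X) (s : R) : set (X * X) :=
  [set p | [/\ B p.1, A p.2 & ball (p.1 : 'rV[R]_n) s (p.2 : 'rV[R]_n)]].

Lemma measurable_crossing_set (A B : set X) (s : R) :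
  measurable A -> measurable B -> measurable (crossing_set A B s).
Proof.
move=> mA mB.
rewrite (_ : crossing_set A B s = (fst @^-1` B) `&` (snd @^-1` A) `&`
    [set p | ball (p.1 : 'rV[R]_n) s (p.2 : 'rV[R]_n)]).
  apply: measurableI; first apply: measurableI.
  - by rewrite -[X in measurable X]setTI; exact: measurable_fst.
  - by rewrite -[X in measurable X]setTI; exact: measurable_snd.
  - exact: (@measurable_ball_rel _ _ R n fst snd (cst s)).
apply/seteqP; split => p /= H; first by case: H => ? ? ?; split.
by case: H => -[? ?] ?; split.
Qed.

Lemma product_crossing_set (A B : set X) (s : R) :
  measurable A -> measurable B ->
  ((beta \x beta) (crossing_set A B s) = crossing A B s)%E.
Proof.
move=> mA mB; rewrite product_measure_xsection /crossing [RHS]integral_mkcond.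
apply: eq_integral => y _; rewrite /patch; case: ifPn => [By|nBy].
  congr (lebesgue_borel R n _); apply/seteqP; split => x; rewrite /xsection/= ?inE; first by case.
  by move: By; rewrite inE => By [].
rewrite (_ : xsection _ _ = set0) ?measure0//.
apply/seteqP; split => // x; rewrite /xsection/= inE => -[/= By].
by move: nBy; rewrite notin_setE.
Qed.

Lemma crossing_sym (A B : set X) (s : R) :
  measurable A -> measurable B -> crossing A B s = crossing B A s.
Proof.
move=> mA mB; rewrite -!product_crossing_set// product_measure_ysection; last first.
  exact: measurable_crossing_set.
rewrite product_measure_xsection; apply: eq_integral => y _.
congr (lebesgue_borel R n _); apply/seteqP.
by split => x; rewrite /xsection /ysection/= !inE => -[/= ? ? ?]; split => //=; exact: ball_sym.
Qed.

Lemma lebesgue_borel_eball (t r : R) : 0 < t ->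
  lebesgue_borel R n (eball (t * r)) = ((t ^+ n)%:E * beta (eball r))%E.
Proof.
move=> t0; have mB : measurable (eball (t * r) : set X) by exact: measurable_eball.
rewrite -(@lebesgue_borel_affine R n t 0 _ t0 mB).
congr (_ * lebesgue_borel R n _)%E; apply/seteqP.
by split => x; rewrite /eball/= addr0 enormZ gtr0_norm// ltr_pM2l.
Qed.

(** Sup distance below [s] means Euclidean distance below [n * s], so only the annulus [S] of that
    width interacts with the exterior. Its measure is at most that of the ball, and at most
    [n ^+ 2 * s * rho ^+ n / r]. *)
Lemma eball_crossing_upper (r rho s : R) : (0 < n)%N -> 0 < rho -> 0 < s ->
  beta (eball r) = (rho ^+ n)%:E ->
  (@crossing R n (~` eball r) (eball r) s <=
   ((2 ^+ n * (1 + 2 * n%:R ^+ 2)) * (s ^+ n * rho ^+ n * (s / (s + rho))))%:E)%E.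
Proof.
move=> n0 rho0 s0 bB.
have n0' : 0 < n%:R :> R by rewrite ltr0n.
have mB : measurable (eball r : set X) by exact: measurable_eball.
have r0 : 0 < r.
  rewrite ltNge; apply/negP => r0.
  move: bB; rewrite (_ : eball r = set0); last first.
    apply/seteqP; split => // x; rewrite /eball/= => /lt_le_trans/(_ r0).
    by rewrite ltNge enorm_ge0.
  by rewrite measure0 => -[/esym/eqP]; rewrite gt_eqF// exprn_gt0.
(* The Euclidean ball lies in the cube of side [2 * r]. *)
have rhor : rho <= 2 * r.
  have : ((rho ^+ n)%:E <= ((2 * r) ^+ n)%:E)%E.
    rewrite -bB -(@lebesgue_borel_ball R n 0 r r0).
    apply: le_measure; rewrite ?inE//; first exact: measurable_ball_rV.
    move=> x; rewrite /eball/= -ball_normE /ball_/= sub0r normrN.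
    exact: le_lt_trans (norm_le_enorm x).
  rewrite lee_fin; apply: contraTT; rewrite -!ltNge => H.
  by rewrite ltrXn2r// ?lt0n_neq0//; rewrite mulr_ge0// ltW.
pose S : set X := eball r `\` eball (r - n%:R * s).
have mS : measurable S by apply: measurableD => //; exact: measurable_eball.
have crS : (@crossing R n (~` eball r) (eball r) s <= ((2 * s) ^+ n)%:E * beta S)%E.
  rewrite -integral_cst// /crossing.
  rewrite [leLHS]integral_mkcond [leRHS]integral_mkcond; apply: le_ge0_integral => y _.
    by rewrite /patch; case: ifPn.
  rewrite /patch; case: ifPn => By; case: ifPn => Sy //=.
  - rewrite -(@lebesgue_borel_ball R n y s s0).
    apply: le_measure; rewrite ?inE//; [|exact: measurable_ball_rV].
    by apply: measurableI; [exact: measurableC|exact: measurable_ball_rV].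
  - rewrite (_ : _ `&` _ = set0) ?measure0//; apply/seteqP; split => // x [/= nBx].
    rewrite -ball_normE /ball_/= => yx; apply: nBx; rewrite /eball/=.
    move: Sy; rewrite notin_setE => Sy.
    have yr : enorm y < r - n%:R * s.
      by rewrite ltNge; apply/negP => H; apply: Sy; split; [exact/set_mem|rewrite /eball/= ltNge H].
    rewrite -(subrK y x); apply: le_lt_trans (enormD _ _) _.
    have := enorm_le_norm (x - y); rewrite distrC => H.
    have : n%:R * `|y - x| <= n%:R * s by rewrite ler_wpM2l// ltW.
    lra.
  - by rewrite lee_fin exprn_ge0// mulr_ge0// ltW.
have bS1 : (beta S <= (rho ^+ n)%:E)%E.
  by rewrite -bB; apply: le_measure; rewrite ?inE// => x [].
have bSfin : beta S = (fine (beta S))%:E.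
  by rewrite fineK// ge0_fin_numE// (le_lt_trans bS1)// ltry.
set v := fine (beta S) in bSfin.
have v1 : v <= rho ^+ n by move: bS1; rewrite bSfin lee_fin.
have v2 : v * r <= n%:R ^+ 2 * s * rho ^+ n.
  have rhon : 0 < rho ^+ n by rewrite exprn_gt0.
  (* When [n * s >= r] the annulus fills the ball, and the full volume [rho ^+ n] suffices. *)
  have [nsr|rns] := ltP (n%:R * s) r; last first.
    apply: (@le_trans _ _ (rho ^+ n * (n%:R * s))).
      by rewrite ler_pM ?(ltW r0)// -lee_fin -bSfin.
    rewrite (_ : _ * s * _ = n%:R * (rho ^+ n * (n%:R * s))); last by lra.
    by rewrite ler_peMl ?ler1n// !mulr_ge0// ltW.
  pose t := (r - n%:R * s) / r.
  have t0 : 0 < t by rewrite divr_gt0// subr_gt0.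
  have bt : beta (eball (r - n%:R * s)) = (t ^+ n * rho ^+ n)%:E.
    by rewrite -[in LHS](divfK (lt0r_neq0 r0) (_ - _)) lebesgue_borel_eball// bB.
  have : (beta S = beta (eball r) - beta (eball (r - n%:R * s)))%E.
    have fB : (beta (eball r) < +oo)%E by rewrite bB ltry.
    rewrite /S measureD//; last exact: measurable_eball.
    congr (_ - lebesgue_borel R n _)%E; rewrite setIidr// => x; rewrite /eball/= => /lt_le_trans; apply.
    by rewrite gerBl mulr_ge0// ltW.
  rewrite bB bt bSfin -EFinB => -[->].
  have t1 : t <= 1 by rewrite ler_pdivrMr// mul1r gerBl mulr_ge0// ltW.
  (* Bernoulli's inequality bounds the volume fraction of the annulus by [n] times its relative
     width. *)
  have bern : 1 - t ^+ n <= n%:R * (1 - t).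
    elim: (n) => [|k IH]; first by rewrite mul0r expr0 subrr.
    rewrite exprS -natr1 mulrDl mul1r.
    have : t ^+ k * (1 - t) <= 1 - t.
      by rewrite ler_piMl ?subr_ge0// exprn_ile1// ltW.
    lra.
  have tr : (1 - t) * r = n%:R * s.
    by rewrite /t mulrBl mul1r divfK ?gt_eqF//; lra.
  rewrite (_ : (_ - _) * r = rho ^+ n * r * (1 - t ^+ n)); last by lra.
  rewrite (_ : _ * s * _ = rho ^+ n * r * (n%:R * (1 - t))).
    by rewrite ler_wpM2l// mulr_ge0// ltW.
  rewrite (_ : _ * _ * (_ * _) = rho ^+ n * n%:R * ((1 - t) * r)); last by lra.
  by rewrite tr; lra.
apply: (le_trans crS); rewrite bSfin -EFinM lee_fin exprMn.
have srho : 0 < s + rho by rewrite addr_gt0.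
rewrite (_ : 2 ^+ n * _ * _ = 2 ^+ n * s ^+ n * ((1 + 2 * n%:R ^+ 2) * rho ^+ n * s / (s + rho))); last by lra.
rewrite ler_wpM2l ?mulr_ge0 ?exprn_ge0 ?(ltW s0)//.
rewrite ler_pdivlMr//.
have v_ge0 : 0 <= v by rewrite fine_ge0.
have : v * s <= rho ^+ n * s by rewrite ler_wpM2r// ltW.
have : v * rho <= v * (2 * r) by rewrite ler_wpM2l.
lra.
Qed.

End crossing_upper.

(** * Kernels and their superlevel sets *)

(* The product of two sigma-finite measures, under a name of its own: on [\x]
   itself the inferred sigma-finite structure asks for subprobabilities. *)
Section sigma_finite_product.
Context d1 d2 (T1 : measurableType d1) (T2 : measurableType d2) (R : realType).
Variables (m1 : {sigma_finite_measure set T1 -> \bar R})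
  (m2 : {sigma_finite_measure set T2 -> \bar R}).

Definition sfprod : set (T1 * T2) -> \bar R := (m1 \x m2)%E.

HB.instance Definition _ := Measure.on sfprod.

Let sfprod_sigma_finite : sigma_finite setT sfprod.
Proof.
by have [] := lebesgue_integral_fubini.measure_function_Measure_isSigmaFinite__to__measure_function_isSigmaFinite m1 m2.
Qed.

HB.instance Definition _ := Measure_isSigmaFinite.Build _ _ _ sfprod
  sfprod_sigma_finite.

End sigma_finite_product.

Section layers.
Context {R : realType} {n : nat}.
Local Notation X := (borel_rV R n).
Local Notation beta := (lebesgue_borel R n).
Local Notation lambda := (@lebesgue_measure R).

Lemma iterated_lebesgue_rV (F : X * X -> \bar R) :
  measurable_fun setT F -> (forall p, 0 <= F p)%E ->
  (\int[@lebesgue_rV R n]_y \int[@lebesgue_rV R n]_x F (y, x) =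
   \int[beta \x beta]_p F p)%E.
Proof.
move=> mF F0; rewrite fubini_tonelli1//.
transitivity (\int[@lebesgue_rV R n]_y \int[beta]_x F (y, x))%E.
  apply: eq_integral => y _; apply: (@integral_lebesgue_rV R n (fun x => F (y, x))) => //.
  by have := @measurable_fun_pair2 _ _ _ X X _ F y mF.
apply: integral_lebesgue_rV; first exact: measurable_fun_fubini_tonelli_F.
by move=> y; exact: integral_ge0.
Qed.

(** Exchanges pairs of points with levels. The variable in [T] is a single level [t] for perimeters
    and a pair of levels [(s, t)] for seminorms. *)
Lemma iterated_lebesgue_rV_xsection d (T : measurableType d)
    (m : {sigma_finite_measure set T -> \bar R}) (Q : set ((X * X) * T)) :
  measurable Q ->
  (\int[@lebesgue_rV R n]_y \int[@lebesgue_rV R n]_x m (xsection Q (y, x)) =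
   \int[m]_t (beta \x beta) (ysection Q t))%E.
Proof.
move=> mQ.
have mF : measurable_fun setT (fun p : X * X => m (xsection Q p)).
  exact: measurable_fun_xsection.
have F0 (p : X * X) : (0 <= m (xsection Q p))%E by [].
rewrite (iterated_lebesgue_rV _ mF F0).
exact: (@product_measure_ysection _ _ _ _ _ (sfprod _ _ _ _ _ beta beta) m Q mQ).
Qed.

(* Kernels of the form [layer phi] turn seminorms into integrals over [t] of
   crossing energies at scale [phi t]. *)
Definition layer (phi : R -> R) (z : 'rV[R]_n) : \bar R :=
  lambda [set t | 0 < t /\ `|z| < phi t].

(** The energies are the measures of the sections of one measurable set [Q]. *)
Lemma measurable_crossing_layer (A B : set X) (phi : R -> R) :
  measurable A -> measurable B -> measurable_fun [set: measurableTypeR R] phi ->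
  measurable_fun [set: measurableTypeR R]
    ((fun t => crossing A B (phi t)) \_ [set t | 0 < t]).
Proof.
move=> mA mB mphi.
pose Q : set ((X * X) * measurableTypeR R) :=
  [set p | 0 < p.2 /\ crossing_set A B (phi p.2) p.1].
have mQ : measurable Q.
  rewrite (_ : Q = [set p | 0 < p.2] `&` ((fst \o fst) @^-1` B `&` (snd \o fst) @^-1` A `&`
      [set p | ball (p.1.1 : 'rV[R]_n) (phi p.2) (p.1.2 : 'rV[R]_n)])).
    apply: measurableI; last apply: measurableI; last 1 first.
    - apply: (@measurable_ball_rel _ _ R n (fun p : (X * X) * measurableTypeR R => p.1.1)
        (fun p => p.1.2) (fun p => phi p.2)).
      + exact: measurableT_comp measurable_fst measurable_fst.
      + exact: measurableT_comp measurable_snd measurable_fst.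
      + exact: measurableT_comp mphi measurable_snd.
    - by apply: measurable_ltr => //; exact: measurable_snd.
    - apply: measurableI; rewrite -[X in measurable X]setTI.
      + by apply: (measurableT_comp measurable_fst measurable_fst) => //; exact: measurableT.
      + by apply: (measurableT_comp measurable_snd measurable_fst) => //; exact: measurableT.
  apply/seteqP; split => p /= H; first by case: H => ? [? ? ?].
  by case: H => ? [[? ?] ?].
rewrite (_ : _ \_ _ = sfprod _ _ _ _ _ beta beta \o ysection Q).
  exact: measurable_fun_ysection.
apply/funext => t; rewrite /patch /=; case: ifPn => t0.
  rewrite -product_crossing_set//; congr (_ _); apply/seteqP.
  by split => p; rewrite /ysection/= inE /Q/=; [split => //; rewrite inE in t0|case].
rewrite (_ : ysection Q t = set0) ?measure0//.
apply/seteqP; split => // p; rewrite /ysection/= inE => -[/= H _].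
by move: t0; rewrite notin_setE.
Qed.

(** A pair separated by the ball is counted in both orders; both orders carry the same energy by
    [crossing_sym], which absorbs the factor 1/2. *)
Lemma perimeter_upper (J : 'rV[R]_n -> \bar R) (phi : R -> R) (r : R) :
  measurable_fun [set: measurableTypeR R] phi ->
  (forall z, 0 <= J z)%E -> (forall z, J z <= layer phi z)%E ->
  (perimeter J (eball r) <=
   \int[lambda]_(t in [set t | (0 < t)%R]) @crossing R n (~` eball r) (eball r) (phi t))%E.
Proof.
move=> mphi J0 JL.
have mB : measurable (eball r : set X) by exact: measurable_eball.
set B : set X := eball r.
pose D : set (X * X) := [set p | (B p.1 /\ ~ B p.2) \/ (~ B p.1 /\ B p.2)].
pose Q : set ((X * X) * measurableTypeR R) :=
  [set p | [/\ D p.1, 0 < p.2 & ball (p.1.1 : 'rV[R]_n) (phi p.2) (p.1.2 : 'rV[R]_n)]].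
have mD : measurable D.
  have mf (A : set X) : measurable A -> measurable [set p : X * X | A p.1].
    by move=> mA; rewrite -[X in measurable X]setTI; exact: measurable_fst.
  have ms (A : set X) : measurable A -> measurable [set p : X * X | A p.2].
    by move=> mA; rewrite -[X in measurable X]setTI; exact: measurable_snd.
  apply: measurableU; apply: measurableI; [exact: mf|exact: (ms _ (measurableC mB))|
    exact: (mf _ (measurableC mB))|exact: ms].
have mQ : measurable Q.
  rewrite (_ : Q = (fst @^-1` D) `&` [set p | 0 < p.2] `&`
      [set p | ball (p.1.1 : 'rV[R]_n) (phi p.2) (p.1.2 : 'rV[R]_n)]).
    apply: measurableI; first apply: measurableI.
    - by rewrite -[X in measurable X]setTI; exact: measurable_fst.
    - by apply: measurable_ltr => //; exact: measurable_snd.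
    - apply: (@measurable_ball_rel _ _ R n (fun p : (X * X) * measurableTypeR R => p.1.1)
        (fun p => p.1.2) (fun p => phi p.2)).
      + exact: measurableT_comp measurable_fst measurable_fst.
      + exact: measurableT_comp measurable_snd measurable_fst.
      + exact: measurableT_comp mphi measurable_snd.
  apply/seteqP; split => p /= H; first by case: H => ? ? ?; split.
  by case: H => -[? ?] ?; split.
have QE y x : lambda (xsection Q (y, x)) = (`|\1_B x - \1_B y|%:E * layer phi (x - y))%E.
  have [Dyx|nD] := pselect (D (y, x)).
    have -> : `|\1_B x - \1_B y| = 1 :> R.
      rewrite !indicE; case: Dyx => /= -[H1 H2].
        by rewrite (mem_set H1) (memNset H2) sub0r normrN1.
      by rewrite (mem_set H2) (memNset H1) subr0 normr1.
    rewrite mul1e; congr (lebesgue_measure _).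
    by apply/seteqP; split => t; rewrite /xsection/= inE /Q/= -ball_normE /ball_/= distrC;
      [case|case=> ? ?; split].
  have -> : `|\1_B x - \1_B y| = 0 :> R.
    rewrite !indicE; have [yB|yB] := boolP (y \in B); have [xB|xB] := boolP (x \in B);
      rewrite ?subrr ?normr0//.
    - by exfalso; apply: nD; left; split; [exact: set_mem|move/mem_set; exact/negP].
    - by exfalso; apply: nD; right; split; [move/mem_set; exact/negP|exact: set_mem].
  rewrite mul0e (_ : xsection _ _ = set0) ?measure0//.
  by apply/seteqP; split => // t; rewrite /xsection/= inE => -[].
rewrite /perimeter.
apply: (@le_trans _ _ (2^-1%:E * \int[@lebesgue_rV R n]_y \int[@lebesgue_rV R n]_x
    lambda (xsection Q (y, x)))%E).
  rewrite lee_wpmul2l ?lee_fin ?invr_ge0//.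
  apply: le_ge0_integral => y _; first by apply: integral_ge0 => x _; rewrite mule_ge0.
  apply: le_ge0_integral => x _; first by rewrite mule_ge0.
  by rewrite QE lee_wpmul2l// lee_fin.
rewrite iterated_lebesgue_rV_xsection// muleC lee_pdivrMr//.
have cr0 t : (0 <= @crossing R n (~` B) B (phi t))%E by exact: crossing_ge0.
have slice t : ((beta \x beta) (ysection Q t) <=
    2%:E * ((fun t => @crossing R n (~` B) B (phi t)) \_ [set t | (0 < t)%R]) t)%E.
  rewrite /patch; case: ifPn => [|t0]; last first.
    rewrite (_ : ysection Q t = set0) ?measure0 ?mule0//.
    apply/seteqP; split => // p; rewrite /ysection/= inE => -[_ /= H _].
    by move: t0; rewrite notin_setE.
  rewrite inE/= => t0.
  have mC : measurable (~` B) by exact: measurableC.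
  rewrite (_ : 2 = 1 + 1)// EFinD ge0_muleDl// mul1e {2}(@crossing_sym _ _ (~` B) B)//.
  rewrite -!product_crossing_set//.
  apply: (@le_trans _ _ ((beta \x beta)%E (crossing_set (~` B) B (phi t) `|`
      crossing_set B (~` B) (phi t)))).
    apply: le_measure; rewrite ?inE; first exact: measurable_ysection.
      by apply: measurableU; exact: measurable_crossing_set.
    move=> p; rewrite /ysection/= inE /Q /D/= => -[+ _ pb].
    by move=> [] [? ?]; [left|right]; split.
  by apply: measureU2; exact: measurable_crossing_set.
rewrite [leRHS]muleC [X in (_ <= _ * X)%E]integral_mkcond -ge0_integralZl//; last 2 first.
- apply: measurable_crossing_layer => //; exact: measurableC.
- by move=> t _; apply: erestrict_ge0 => ? _; exact: cr0.
by apply: le_ge0_integral => t _; [exact: measure_ge0|exact: slice].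
Qed.

End layers.

Section level_radius.
Context {R : realType} {n : nat}.
Local Notation X := (borel_rV R n).
Local Notation beta := (lebesgue_borel R n).
Local Notation mu := (@lebesgue_rV R n).
Local Notation lambda := (@lebesgue_measure R).
Implicit Type K : 'rV[R]_n -> \bar R.

(* Comparable to the radius of [{K > t}^*]; the value is [0] when [{K > t}] has
   infinite measure, which is harmless as [set_rearr] is then empty too. *)
Definition level_radius K (t : R) : R :=
  fine (mu [set y | (t%:E < K y)%E]) `^ n%:R^-1.

Lemma level_radius_ge0 K t : 0 <= level_radius K t.
Proof. exact: powR_ge0. Qed.

Lemma level_radiusX K t : (0 < n)%N ->
  level_radius K t ^+ n = fine (mu [set y | (t%:E < K y)%E]).
Proof.
move=> n0; rewrite /level_radius -powR_mulrn ?powR_ge0// -powRrM mulVf ?powRr1//.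
  by rewrite fine_ge0// outer_measure_ge0.
by rewrite pnatr_eq0 -lt0n.
Qed.

Lemma measurable_level K (t : R) :
  measurable_fun [set: lebesgue_type R n] (K : lebesgue_type R n -> \bar R) ->
  measurable ([set y | (t%:E < K y)%E] : set (lebesgue_type R n)).
Proof.
move=> mK; rewrite -[X in measurable X]setTI.
exact: emeasurable_fun_o_infty.
Qed.

Lemma measurable_level_radius K :
  measurable_fun [set: lebesgue_type R n] (K : lebesgue_type R n -> \bar R) ->
  measurable_fun [set: measurableTypeR R] (level_radius K).
Proof.
move=> mK.
have mv : measurable_fun [set: measurableTypeR R]
    (fun t : measurableTypeR R => mu [set y | (t%:E < K y)%E]).
  move=> mT; apply: (measurability _ (ErealGenOInfty.measurableE R)) => // _ [_ [r ->] <-].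
  (* The measure of [{K > t}] is nonincreasing in [t], so the preimage of a ray is an interval. *)
  rewrite setTI; apply: is_interval_measurable => s t /= vs vt u /andP[su ut].
  move: vs vt; rewrite !in_itv/= !andbT => vs vt; apply: lt_le_trans vt _.
  apply: le_measure; rewrite ?inE; [exact: measurable_level|exact: measurable_level|].
  by move=> y /=; apply: le_lt_trans; rewrite lee_fin.
apply: (measurableT_comp (measurable_powR _)).
exact: (measurableT_comp (@fine_measurable R _ measurableT) mv).
Qed.

(* If [N x < c rho(t)], the set [{N <= N x}] is too small to contain [{K > t}], so
   that monotonicity compares [K x] with some [K y > t]. *)
Lemma layer_le_kernel K (N : 'rV[R]_n -> R) (c0 : R) : (0 < n)%N ->
  is_norm N -> (forall x, 0 <= K x)%E ->
  measurable_fun [set: lebesgue_type R n] (K : lebesgue_type R n -> \bar R) ->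
  0 < c0 -> (forall x y, N x <= N y -> (c0%:E * K y <= K x)%E) ->
  exists a : R, [/\ 0 < a, a <= 1 &
    forall x, (c0%:E * layer (fun t => a * level_radius K t)%R x <= K x)%E].
Proof.
move=> n0 hN K0 mK c00 Kmon.
have [C [C0 NC]] := is_norm_le_norm N hN; have [c [cgt0 cN]] := norm_le_is_norm N hN.
(* With [a <= c / (4 * C)], the cube that would contain [{K > t}] has side at most [rho / 2], too
   small for its measure; [a <= 1] serves later to compare [a] with the dimension. *)
pose a := Num.min 1 (c / (4 * C)).
have C4 : 0 < 4 * C by rewrite mulr_gt0.
have a0 : 0 < a by rewrite lt_min ltr01 divr_gt0.
have a1 : a <= 1 by rewrite ge_min lexx.
have aC : a * (4 * C) <= c by rewrite -ler_pdivlMr// ge_min lexx orbT.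
exists a; split => // x.
have key t : 0 < t -> `|x| < a * level_radius K t -> ((c0 * t)%:E <= K x)%E.
  move=> t0 xt; set rho := level_radius K t in xt.
  have rho0 : 0 < rho.
    by rewrite -(pmulr_rgt0 _ a0); apply: le_lt_trans xt.
  suff [y Ky Nxy] : exists2 y, (t%:E < K y)%E & N x <= N y.
    apply: le_trans (Kmon x y Nxy); rewrite EFinM lee_pmul2l//.
    exact: ltW.
  apply: contrapT => /forall2NP H.
  pose r := C * (a * rho) / c.
  have r0 : 0 < r by rewrite divr_gt0// !mulr_gt0.
  have sub : [set y | (t%:E < K y)%E] `<=` ball (0 : 'rV[R]_n) r.
    move=> y Ky; rewrite -ball_normE /ball_/= sub0r normrN /r ltr_pdivlMr//.
    have [//|/negP] := H y; rewrite -ltNge => Nyx.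
    rewrite mulrC; apply: le_lt_trans (cN y) _; apply: lt_trans Nyx _.
    by apply: le_lt_trans (NC x) _; rewrite ltr_pM2l.
  have mKt := measurable_level K t mK.
  have vr : (mu [set y | (t%:E < K y)%E] <= ((2 * r) ^+ n)%:E)%E.
    rewrite -(@lebesgue_borel_ball R n 0 r r0) -lebesgue_rVE; last exact: measurable_ball_rV.
    apply: le_measure; rewrite ?inE//.
    by apply: measurable_lebesgue_rV; exact: measurable_ball_rV.
  have vE : rho ^+ n <= (2 * r) ^+ n.
    rewrite /rho level_radiusX// -lee_fin fineK//.
    by rewrite ge0_fin_numE ?(le_lt_trans vr) ?ltry// outer_measure_ge0.
  have : 2 * r <= rho / 2.
    rewrite /r mulrA ler_pdivrMr//.
    have : a * (4 * C) * rho <= c * rho by rewrite ler_wpM2r// ltW.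
    lra.
  move=> r2; have : (2 * r) ^+ n < rho ^+ n.
    have r2' : 2 * r < rho by lra.
    by rewrite ltrXn2r// ?lt0n_neq0// mulr_ge0// ltW.
  by rewrite ltNge vE.
have := K0 x; case: (K x) key => [k key k0|key _|//]; last by rewrite leey.
rewrite lee_fin in k0.
have mrho := measurable_level_radius K mK.
(* When [K x = k] is finite, all levels counted by the layer are at most [k / c0]. *)
apply: (@le_trans _ _ (c0%:E * lambda `]0%R, (k / c0)%R]%classic)%E).
  rewrite lee_pmul2l//; apply: le_measure; rewrite ?inE//.
    apply: measurableI; apply: measurable_ltr => //.
    exact: measurable_funM.
  move=> t /= [t0 /(key t t0)]; rewrite lee_fin in_itv/= t0/= => H.
  by rewrite ler_pdivlMr// mulrC.
rewrite lebesgue_measure_itv/= lte_fin; case: ifPn => _; last by rewrite mule0 lee_fin.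
by rewrite sube0 -EFinM lee_fin mulrC divfK ?gt_eqF.
Qed.

(* When no ball has the required measure, [get] returns [0] and the ball is
   empty. *)
Lemma set_rearr_sub K t x : (0 < n)%N ->
  set_rearr [set y | (t%:E < K y)%E] x -> `|x| < n%:R * level_radius K t.
Proof.
move=> n0; rewrite /set_rearr; case: ifPn => // _.
rewrite /ball_vol; set v := fine _; set P := (X in get X).
have [Pex|Pn] := pselect (exists r, P r); last first.
  rewrite getPN => [|r Pr]; last by apply: Pn; exists r.
  by rewrite /eball/= ltNge enorm_ge0.
have [] := getPex Pex; set r := get P => r0 rv.
rewrite /eball/= => xr; apply: le_lt_trans (norm_le_enorm x) _.
apply: lt_le_trans xr _.
have n0' : 0 < n%:R :> R by rewrite ltr0n.
have rn0 : 0 < r / n%:R by rewrite divr_gt0.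
(* The cube of side [2 * r / n] lies inside the Euclidean ball of radius [r]. *)
have : ((2 * (r / n%:R)) ^+ n <= level_radius K t ^+ n).
  rewrite level_radiusX// -lee_fin -rv.
  rewrite -(@lebesgue_borel_ball R n 0 _ rn0) -lebesgue_rVE; last exact: measurable_ball_rV.
  apply: le_measure; rewrite ?inE; try by apply: measurable_lebesgue_rV;
    [exact: measurable_ball_rV || exact: measurable_eball].
  move=> y; rewrite -ball_normE /ball_/= sub0r normrN => yr.
  apply: le_lt_trans (enorm_le_norm y) _.
  by rewrite mulrC -ltr_pdivlMr.
move=> H; have H2 : 2 * (r / n%:R) <= level_radius K t.
  rewrite leNgt; apply/negP => H2; move: H; rewrite leNgt => /negP; apply.
  by rewrite ltrXn2r// ?lt0n_neq0// level_radius_ge0.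
rewrite mulrC -ler_pdivrMr//; lra.
Qed.

Lemma fun_rearr_le_layer K x : (0 < n)%N ->
  measurable_fun [set: lebesgue_type R n] (K : lebesgue_type R n -> \bar R) ->
  (fun_rearr K x <= layer (fun t => n%:R * level_radius K t)%R x)%E.
Proof.
move=> n0 mK; rewrite /fun_rearr /layer.
have mrho := measurable_level_radius K mK.
pose S : set (measurableTypeR R) := [set t | 0 < t /\ `|x| < n%:R * level_radius K t].
have mS : measurable S.
  by apply: measurableI; apply: measurable_ltr => //; exact: measurable_funM.
rewrite -/S.
apply: (@le_trans _ _ (\int[lambda]_(t in `]0%R, +oo[) (\1_S t)%:E)%E).
  apply: le_ge0_integral => t; first by rewrite lee_fin indicE.
  rewrite /= in_itv/= andbT => t0; rewrite lee_fin !indicE.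
  case: (boolP (x \in _)) => // /set_mem /(set_rearr_sub _ _ _ n0) xt.
  by rewrite mem_set.
by rewrite integral_indic//; apply: le_measure; rewrite ?inE//; exact: measurableI.
Qed.

(* On [{h / 2 <= |z|}] the weight [min 1 |z|] is bounded below, and this set meets
   [{|z| < s}] in a fixed proportion as soon as [s > h]. *)
Lemma layer_tail (a h : R) (rho : R -> R) : (0 < n)%N -> 0 < a -> 0 < h ->
  measurable_fun [set: measurableTypeR R] rho ->
  (\int[mu]_z (layer (fun t => a * rho t)%R z * (Num.min 1 (enorm z))%:E) < +oo)%E ->
  (\int[lambda]_(t in [set t | (0 < t)%R /\ (h < a * rho t)%R]) (rho t ^+ n)%:E < +oo)%E.
Proof.
move=> n0 a0 h0 mrho fin.
pose g : R := Num.min 1 (h / 2).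
have g0 : 0 < g by rewrite lt_min ltr01 divr_gt0.
pose Z : set X := [set z | h / 2 <= enorm z].
have mZ : measurable Z.
  rewrite (_ : Z = ~` eball (h / 2)); first by apply: measurableC; exact: measurable_eball.
  by apply/seteqP; split => z; rewrite /Z/eball/= leNgt => /negP.
pose Q : set (X * measurableTypeR R) :=
  [set p | [/\ Z p.1, 0 < p.2 & `|p.1 : 'rV[R]_n| < a * rho p.2]].
have mQ : measurable Q.
  rewrite (_ : Q = (fst @^-1` Z) `&` [set p | 0 < p.2] `&`
      [set p | `|p.1 : 'rV[R]_n| < a * rho p.2]).
    apply: measurableI; first apply: measurableI.
    - by rewrite -[X in measurable X]setTI; exact: measurable_fst.
    - by apply: measurable_ltr => //; exact: measurable_snd.
    - apply: measurable_ltr; first exact: measurableT_comp (@measurable_norm_rV R n) measurable_fst.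
      by apply: measurable_funM => //; exact: measurableT_comp mrho measurable_snd.
  apply/seteqP; split => p /= H; first by case: H => ? ? ?; split.
  by case: H => -[? ?] ?; split.
have finQ : (\int[lambda]_t beta (ysection Q t) < +oo)%E.
  rewrite -(@product_measure_ysection _ _ _ _ _ beta lambda)// product_measure_xsection.
  rewrite -integral_lebesgue_rV//; last exact: measurable_fun_xsection.
  have : (g%:E * \int[mu]_z lambda (xsection Q z) < +oo)%E.
    apply: le_lt_trans fin.
    have mxi : measurable_fun [set: lebesgue_type R n] (fun z => lambda (xsection Q z)).
      apply: (@measurable_fun_lebesgue_rV R n _ _ (fun z => lambda (xsection Q z))).
      exact: measurable_fun_xsection.
    have g0E : (0 <= g%:E)%E by rewrite lee_fin ltW.
    rewrite -(ge0_integralZl mu measurableT mxi (fun _ _ => measure_ge0 _ _) g0E).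
    apply: le_ge0_integral => z _; first by rewrite mule_ge0// lee_fin ltW.
    have [Zz|nZ] := pselect (Z z); last first.
      rewrite (_ : xsection Q z = set0).
        rewrite measure0 mule0 mule_ge0//.
        by rewrite lee_fin le_min ler01 enorm_ge0.
      by apply/seteqP; split => // t; rewrite /xsection/= inE => -[].
    rewrite muleC lee_pmul ?lee_fin//.
      rewrite /layer le_eqVlt; apply/orP; left; apply/eqP.
      congr (lebesgue_measure _).
      by apply/seteqP; split => t; rewrite /xsection/= inE => -[]//; split.
    rewrite le_min !ge_min lexx/=; apply/orP; right; exact: Zz.
  set I := (\int[mu]_z _)%E.
  have : (0 <= I)%E by exact: integral_ge0.
  by case: I => [r _ _|_|//]; [exact: ltry|rewrite gt0_muley ?lte_fin].
have ca : 0 < (2 / a) ^+ n by rewrite exprn_gt0// divr_gt0.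
apply: (@le_lt_trans _ _ (((2 / a) ^+ n)%:E * \int[lambda]_t beta (ysection Q t))%E); last first.
  by rewrite lte_mul_pinfty// lee_fin ltW.
rewrite -ge0_integralZl ?lee_fin ?(ltW ca)//; last exact: measurable_fun_ysection.
rewrite [leLHS]integral_mkcond; apply: le_ge0_integral => t _.
  rewrite /patch; case: ifPn => // /set_mem[_ ht]; rewrite lee_fin exprn_ge0//.
  by rewrite -(pmulr_rge0 _ a0) ltW// (lt_trans h0).
rewrite /patch; case: ifPn => [/set_mem/=[t0 ht]|_]; last by rewrite mule_ge0// lee_fin ltW.
pose s := a * rho t.
have s0 : 0 < s by exact: lt_trans ht.
(* The points with all coordinates between [s / 2] and [s] form a cube that lies in [{|z| < s}] and
   avoids the Euclidean ball of radius [h / 2]; its measure [(s / 2) ^+ n] equals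
   [(a / 2) ^+ n * rho t ^+ n]. *)
pose z0 : 'rV[R]_n := const_mx (3 / 4 * s).
have s4 : 0 < s / 4 by rewrite divr_gt0.
apply: (@le_trans _ _ (((2 / a) ^+ n)%:E * beta (ball z0 (s / 4)))%E).
  rewrite lebesgue_borel_ball// -EFinM lee_fin -exprMn.
  suff -> : 2 / a * (2 * (s / 4)) = rho t by [].
  have -> : 2 / a * (2 * (s / 4)) = a^-1 * s by lra.
  by rewrite /s mulKf// gt_eqF.
rewrite lee_pmul2l ?lte_fin//.
apply: le_measure; rewrite ?inE; [exact: measurable_ball_rV|exact: measurable_ysection|].
move=> y; rewrite -ball_normE /ball_/= => /norm_rV_lt -/(_ s4) yz.
have ys i : s / 2 < y ord0 i < s.
  by have := yz i; rewrite /z0 !mxE ltr_norml => /andP[h1 h2]; apply/andP; split; lra.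
rewrite /ysection/= inE; split => //=.
  rewrite /Z/=; apply: le_trans (norm_le_enorm y).
  have /andP[h1 _] := ys (Ordinal n0).
  apply: le_trans (coord_rV_le_norm y (Ordinal n0)).
  by apply: le_trans (ler_norm _); rewrite /s in h1; lra.
apply/norm_rV_lt => // i; have /andP[h1 h2] := ys i.
rewrite /s in h1 h2 s0; by rewrite ltr_norml; apply/andP; split; lra.
Qed.

End level_radius.

(** * Isoperimetric inequality relative to the domain *)

Section relative_isoperimetric_inequality.
Context {R : realType} {n : nat}.
Local Notation X := (borel_rV R n).
Local Notation beta := (lebesgue_borel R n).
Local Notation lambda := (@lebesgue_measure R).

Lemma crossing_le0 (A B : set X) (s : R) : s <= 0 -> crossing A B s = 0%E.
Proof.
move=> s0; rewrite /crossing integral0_eq// => y _.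
rewrite (_ : _ `&` _ = set0) ?measure0//; apply/seteqP; split => // x [_].
by rewrite -ball_normE /ball_/= => /lt_le_trans/(_ s0); rewrite normr_lt0.
Qed.

(* Common order of magnitude of the upper and lower bounds on crossing energies at
   scale [s] for sets of measure [r ^+ n]. *)
Definition profile (r s : R) : R := s ^+ n * r ^+ n * (s / (s + r)).

Lemma profile_ge0 r s : 0 <= r -> 0 <= s -> 0 <= profile r s.
Proof. by move=> r0 s0; rewrite !mulr_ge0 ?exprn_ge0// invr_ge0 addr_ge0. Qed.

Lemma profile_le r s : 0 <= r -> 0 <= s -> profile r s <= s ^+ n * r ^+ n.
Proof.
move=> r0 s0; rewrite ler_piMr ?mulr_ge0 ?exprn_ge0//.
have [->|sr0] := eqVneq (s + r) 0; first by rewrite invr0 mulr0.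
rewrite ler_pdivrMr ?mul1r ?lerDl// lt_neqAle eq_sym sr0.
exact: addr_ge0.
Qed.

(** Allows passing, with [c = b / a], from the scale of the layer above [J] to the scale of the
    energy in [Omega]. *)
Lemma profile_scale (c r s : R) : 1 <= c -> 0 < r -> 0 <= s ->
  profile r (c * s) <= c ^+ n.+1 * profile r s.
Proof.
move=> c1 r0 s0; rewrite /profile exprMn exprS.
have c0 : 0 < c by exact: lt_le_trans c1.
have sr0 : 0 < s + r by rewrite ltr_wpDl.
have csr0 : 0 < c * s + r by rewrite ltr_wpDl// mulr_ge0// ltW.
have H : c * s / (c * s + r) <= c * (s / (s + r)).
  rewrite mulrA ler_wpM2l ?mulr_ge0 ?(ltW c0)// lef_pV2 ?posrE//.
  by rewrite lerD2r ler_peMl.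
have A0 : 0 <= c ^+ n * s ^+ n * r ^+ n.
  by rewrite !mulr_ge0 ?exprn_ge0// ltW.
by have := ler_wpM2l A0 H; lra.
Qed.

Lemma measurable_profile (r : R) (f : R -> R) : 0 < r -> (forall t, 0 <= f t) ->
  measurable_fun [set: measurableTypeR R] f ->
  measurable_fun [set: measurableTypeR R] (fun t => profile r (f t)).
Proof.
move=> r0 f0 mf.
(* Truncation at 0 makes the quotient nondecreasing on the whole line, hence measurable. *)
pose h (x : R) := Num.max x 0 / (Num.max x 0 + r).
have mh : measurable_fun [set: R] h.
  apply: nondecreasing_measurable => // x y xy; rewrite /h.
  have x0 : 0 <= Num.max x 0 by rewrite le_max lexx orbT.
  have y0 : 0 <= Num.max y 0 by rewrite le_max lexx orbT.
  have : Num.max x 0 <= Num.max y 0 by rewrite ge_max !le_max xy lexx orbT.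
  move: x0 y0; set u := Num.max x 0; set v := Num.max y 0 => u0 v0 uv.
  have ur : 0 < u + r by rewrite ltr_wpDl.
  have vr : 0 < v + r by rewrite ltr_wpDl.
  rewrite ler_pdivrMr// mulrAC ler_pdivlMr//.
  have : u * r <= v * r by rewrite ler_wpM2r// ltW.
  lra.
rewrite (_ : (fun t => _) = fun t => f t ^+ n * r ^+ n * (h \o f) t); last first.
  by apply/funext => t; rewrite /profile /h/= (max_idPl (f0 t)).
apply: measurable_funM; last exact: measurableT_comp mh mf.
by apply: measurable_funM => //; exact: measurable_funX.
Qed.

(** The hypothesis on [J] bounds [m ^ (1/q)] by an integral of [profile r] over the levels. Scales
    up to [s0] are handled by [lipschitz_crossing_lower], larger ones by the integrable tail; for
    sets of measure above [rho1 ^+ n], [q >= 1] makes [m ^ (1/q)] at most a constant times [m]. *)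
Lemma relative_isoperimetric_inequality (Omega : set 'rV[R]_n) (rho : R -> R)
    (J : 'rV[R]_n -> \bar R) (a b q C1 : R) : (0 < n)%N ->
  bounded_set Omega -> open Omega -> lipschitz_boundary Omega ->
  0 < a -> a <= b -> 1 <= q -> 0 < C1 ->
  (forall t, 0 <= rho t) -> measurable_fun [set: measurableTypeR R] rho ->
  (forall z, 0 <= J z)%E ->
  (forall z, J z <= layer (fun t => b * rho t)%R z)%E ->
  (forall h, 0 < h ->
    (\int[lambda]_(t in [set t | (0 < t)%R /\ (h < a * rho t)%R])
      (rho t ^+ n)%:E < +oo)%E) ->
  (forall m, 0 < m -> ((m `^ q^-1 / C1)%:E <= perimeter J (ball_vol m))%E) ->
  exists A : R, 0 < A /\ forall (E : set X) (m : R), measurable E ->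
    E `<=` Omega -> beta E = m%:E ->
    ((m `^ q^-1)%:E <= A%:E * ((\int[lambda]_(t in [set t | (0 < t)%R])
       crossing (Omega `\` E) E (a * rho t)%R) + m%:E))%E.
Proof.
move=> n0 bO oO lO a0 ab q1 C10 rho0 mrho J0 JL tail iso.
have q0 : 0 < q by exact: lt_le_trans q1.
have mO : measurable (Omega : set X) by exact: open_measurable_rV.
have b0 : 0 < b by exact: lt_le_trans ab.
have [c [s0 [rho1 [c_gt0 s0_gt0 rho1_gt0 low]]]] :=
  @lipschitz_crossing_lower R n Omega n0 bO oO lO.
pose T0 := (\int[lambda]_(t in [set t | (0 < t)%R /\ (s0 < a * rho t)%R])
  (rho t ^+ n)%:E)%E.
have T0fin : (T0 < +oo)%E := tail _ s0_gt0.
have T00 : (0 <= T0)%E by apply: integral_ge0 => t _; rewrite lee_fin exprn_ge0.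
pose k := fine T0.
have T0E : T0 = k%:E by rewrite fineK// ge0_fin_numE.
have k0 : 0 <= k by rewrite fine_ge0.
have mpos : measurable ([set t | 0 < t] : set (measurableTypeR R)) by exact: measurable_ltr.
pose D := 2 ^+ n * (1 + 2 * n%:R ^+ 2) * (b / a) ^+ n.+1.
have D0 : 0 < D.
  by rewrite !mulr_gt0 ?exprn_gt0 ?divr_gt0// ltr_pwDl// mulr_ge0// exprn_ge0.
pose C2 := C1 * D.
have C20 : 0 < C2 by rewrite mulr_gt0.
have step1 r : 0 < r -> (((r ^+ n) `^ q^-1)%:E <=
    C2%:E * \int[lambda]_(t in [set t | (0 < t)%R]) (profile r (a * rho t)%R)%:E)%E.
  move=> r0; have m0 : 0 < r ^+ n by rewrite exprn_gt0.
  have mprof : measurable_fun [set: measurableTypeR R] (fun t => (profile r (a * rho t))%:E).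
    apply/measurable_EFinP; apply: measurable_profile => //.
    - by move=> t; rewrite mulr_ge0// ltW.
    - exact: measurable_funM.
  (* Without a ball of measure [r ^+ n], [ball_vol] would be empty and its perimeter 0, against the
     hypothesis. *)
  have [[r' [r'0 r'v]]|no] := pselect (exists r', 0 < r' /\
      @lebesgue_rV R n (eball r') = (r ^+ n)%:E); last first.
    exfalso; have := iso _ m0.
    rewrite (_ : ball_vol _ = set0); last first.
      rewrite /ball_vol getPN => [|r' Pr']; last by apply: no; exists r'.
      apply/seteqP; split => // x; rewrite /eball/=.
      by rewrite ltNge enorm_ge0.
    rewrite leNgt => /negP; apply.
    rewrite /perimeter integral0_eq => [|y _]; last first.
      by rewrite integral0_eq// => x _; rewrite !indicE !in_set0 subrr normr0 mul0e.
    by rewrite mule0 lte_fin divr_gt0// powR_gt0.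
  have : exists r'', beta (eball r'') = (r ^+ n)%:E /\ ball_vol (r ^+ n) = eball r'' :> set 'rV[R]_n.
    rewrite /ball_vol; set P := (X in get X).
    have [_] : P (get P) by apply: getPex; exists r'.
    by rewrite lebesgue_rVE; [exists (get P)|exact: measurable_eball].
  move=> [r'' [r''v ballE]].
  have := iso _ m0; rewrite ballE => /le_trans/(_ (perimeter_upper J _ r'' _ J0 JL)) H.
  have mbrho : measurable_fun [set: measurableTypeR R] (fun t => b * rho t).
    exact: measurable_funM.
  have {}H := H mbrho.
  rewrite -[leLHS]mul1e -(divff (lt0r_neq0 C10)) EFinM -muleA -EFinM (mulrC C1^-1).
  rewrite /C2 !(EFinM C1) -[leRHS]muleA.
  apply: lee_wpmul2l; first by rewrite lee_fin ltW.
  apply: (le_trans H); rewrite -ge0_integralZl//; first last.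
  - by rewrite lee_fin ltW.
  - by move=> t _; rewrite lee_fin profile_ge0 ?mulr_ge0 ?(ltW r0) ?(ltW a0).
  - exact: measurable_funTS.
  apply: le_ge0_integral => t t0; first exact: crossing_ge0.
  have := rho0 t; rewrite le_eqVlt => /predU1P[<-|rt].
    by rewrite !mulr0 crossing_le0// -EFinM lee_fin mulr_ge0 ?(ltW D0)// profile_ge0// ltW.
  have bt : 0 < b * rho t by rewrite mulr_gt0.
  apply: (le_trans (@eball_crossing_upper R n r'' r _ n0 r0 bt r''v)).
  rewrite -EFinM lee_fin -/(profile r (b * rho t)) /D -[leRHS]mulrA ler_wpM2l//.
  rewrite (_ : b * rho t = b / a * (a * rho t)); last by rewrite mulrA divfK// gt_eqF.
  apply: profile_scale => //; first by rewrite ler_pdivlMr// mul1r.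
  by rewrite mulr_ge0// ltW.
(* For [m >= rho1 ^+ n] the quotient [m ^ (1/q) / m] is largest at the left end, since [q >= 1]. *)
pose B := (rho1 ^+ n) `^ q^-1 / rho1 ^+ n.
have rho1n : 0 < rho1 ^+ n by rewrite exprn_gt0.
have B0 : 0 < B by rewrite divr_gt0// powR_gt0.
(* One term for each regime: small scales, large scales, large sets. *)
pose A := C2 * c^-1 + C2 * (a ^+ n * k) + B.
have A1 : 0 < C2 * c^-1 by rewrite divr_gt0.
have A2 : 0 <= C2 * (a ^+ n * k).
  exact: mulr_ge0 (ltW C20) (mulr_ge0 (exprn_ge0 n (ltW a0)) k0).
have A0 : 0 < A by rewrite ltr_wpDl// addr_ge0// ltW.
exists A; split => // E m mE EO bE.
have m_ge0 : 0 <= m by rewrite -lee_fin -bE.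
set I := (\int[lambda]_(t in _) _)%E.
have I0 : (0 <= I)%E by apply: integral_ge0 => t _; exact: crossing_ge0.
have [->|mneq0] := eqVneq m 0.
  rewrite powR0 ?invr_eq0 ?gt_eqF// adde0.
  by rewrite mule_ge0// lee_fin ltW.
have m0 : 0 < m by rewrite lt_neqAle eq_sym mneq0.
have split_goal (x y : R) : 0 <= x -> x <= A -> 0 <= y -> y <= A ->
    ((m `^ q^-1)%:E <= x%:E * I + (y * m)%:E)%E ->
    ((m `^ q^-1)%:E <= A%:E * (I + m%:E))%E.
  move=> x0 xA y0 yA H; apply: le_trans H _.
  rewrite [leRHS]ge0_muleDr ?lee_fin// leeD//; first by rewrite lee_wpmul2r// lee_fin.
  by rewrite -EFinM lee_fin ler_wpM2r.
pose r := m `^ n%:R^-1.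
have r0 : 0 < r by rewrite powR_gt0.
have rn : r ^+ n = m.
  rewrite -powR_mulrn ?powR_ge0// -powRrM mulVf ?powRr1//.
  by rewrite pnatr_eq0 -lt0n.
have [rr1|r1r] := leP r rho1; last first.
  apply: (split_goal 0 B) => //.
  - by rewrite ltW.
  - by rewrite ltW.
  - by rewrite /A; lra.
  rewrite mul0e add0e lee_fin /B mulrAC.
  have m1 : 1 <= m / rho1 ^+ n.
    by rewrite ler_pdivlMr// mul1r -rn lerXn2r ?nnegrE ?(ltW r0) ?(ltW rho1_gt0)// ltW.
  have -> : m `^ q^-1 = (rho1 ^+ n) `^ q^-1 * (m / rho1 ^+ n) `^ q^-1.
    by rewrite -powRM ?(ltW rho1n) ?divr_ge0 ?(ltW rho1n)// mulrC divfK// gt_eqF.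
  rewrite -mulrA ler_wpM2l ?powR_ge0//.
  by rewrite ler1_powR// invf_le1.
apply: (split_goal (C2 * c^-1) (C2 * (a ^+ n * k))) => //.
- by rewrite ltW.
- by rewrite /A; lra.
- by rewrite /A; lra.
have := step1 r r0; rewrite rn => /le_trans; apply.
have c1 : 0 <= c^-1 by rewrite invr_ge0 ltW.
have am0 : 0 <= a ^+ n * m by rewrite mulr_ge0// exprn_ge0// ltW.
have -> : ((C2 * c^-1)%:E * I + (C2 * (a ^+ n * k) * m)%:E =
    C2%:E * (c^-1%:E * I + (a ^+ n * k * m)%:E))%E.
  rewrite [RHS]ge0_muleDr; [|by rewrite mule_ge0 ?lee_fin|].
    by rewrite muleA -!EFinM !mulrA.
  by rewrite lee_fin mulrAC mulr_ge0.
apply: lee_wpmul2l; first by rewrite lee_fin ltW.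
rewrite (mulrAC _ k) EFinM -T0E /I /T0.
rewrite [X in (_ * X + _)%E]integral_mkcond [X in (_ + _ * X)%E]integral_mkcond.
set f1 := (_ \_ _); set f2 := (_ \_ _).
have mf1 : measurable_fun [set: measurableTypeR R] f1.
  apply: (@measurable_crossing_layer R n _ _ (fun t => a * rho t)) => //.
    exact: measurableD.
  exact: measurable_funM.
have mf2 : measurable_fun [set: measurableTypeR R] f2.
  have mD0 : measurable ([set t | 0 < t /\ s0 < a * rho t] : set (measurableTypeR R)).
    by apply: measurableI => //; apply: measurable_ltr => //; exact: measurable_funM.
  apply/(measurable_restrictT _ mD0).
  apply: measurable_funTS; apply/measurable_EFinP; exact: measurable_funX.
have f10 t : (0 <= f1 t)%E by apply: erestrict_ge0 => ? _; exact: crossing_ge0.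
have f20 t : (0 <= f2 t)%E.
  by apply: erestrict_ge0 => ? _; rewrite lee_fin exprn_ge0.
rewrite -ge0_integralZl ?lee_fin// -[X in (_ <= _ + X)%E]ge0_integralZl ?lee_fin//.
rewrite -ge0_integralD//; first last.
- exact: emeasurable_funM.
- by move=> t _; rewrite mule_ge0.
- exact: emeasurable_funM.
- by move=> t _; rewrite mule_ge0.
rewrite [leLHS]integral_mkcond; apply: le_ge0_integral => t _.
  apply: erestrict_ge0 => ? _; rewrite lee_fin profile_ge0 ?(ltW r0)//.
  by rewrite mulr_ge0// ltW.
rewrite [leLHS]/patch; case: ifPn => [|_]; last by rewrite adde_ge0// mule_ge0.
move=> tpos; rewrite /f1 /f2 /patch tpos.
have art : 0 <= a * rho t by rewrite mulr_ge0// ltW.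
(* At scales above [s0], [profile] is at most [a ^+ n * rho t ^+ n * m], which the tail integral
   absorbs. *)
case: ifPn => [_|].
  rewrite -[leLHS]add0e leeD//; first by rewrite mule_ge0// crossing_ge0.
  rewrite -EFinM lee_fin; apply: le_trans (profile_le _ _ (ltW r0) art) _.
  by rewrite rn exprMn; lra.
rewrite notin_setE/= => nin; rewrite mule0 adde0.
have ars0 : a * rho t <= s0.
  by rewrite leNgt; apply/negP => H; apply: nin; split => //; move: tpos; rewrite inE.
move: art; rewrite le_eqVlt => /predU1P[<-|art].
  rewrite /profile mul0r mulr0 mule_ge0 ?crossing_ge0//.
rewrite lee_pdivlMl//.
have := low E r _ mE EO r0 rr1 art ars0; rewrite rn => /(_ bE).
by rewrite EFinM /profile rn.
Qed.

End relative_isoperimetric_inequality.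

(** * Coarea formula and the embedding *)

Section borel_representatives.
Context {R : realType} {n : nat}.
Local Notation X := (borel_rV R n).
Local Notation beta := (lebesgue_borel R n).
Local Notation mu := (@lebesgue_rV R n).

(** On an arbitrary [A], [mu] is the outer measure; covers that are optimal up to [1 / (k + 1)] are
    intersected over [k]. *)
Lemma borel_hull (A : set X) : exists G : set X,
  [/\ measurable G, A `<=` G & (beta G <= mu A)%E].
Proof.
have [Afin|] := boolP (mu A \is a fin_num); last first.
  rewrite ge0_fin_numE ?outer_measure_ge0// ltey negbK => /eqP ->.
  by exists setT; split => //; exact: leey.
have /choice[C CP] : forall k : nat, exists C : (set X)^nat,
    measurable_cover A C /\ (\sum_(i <oo) beta (C i) <= mu A + k.+1%:R^-1%:E)%E.
  move=> k; have e0 : 0 < (k.+1%:R^-1 : R) by [].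
  have [_ /= [C AC <-] Ck] := lb_ereal_inf_adherent e0 Afin.
  by exists C; split => //; exact: ltW.
have mC k i : measurable (C k i) by have [[+ _] _] := CP k; apply.
exists (\bigcap_k \bigcup_i C k i); split.
- by apply: bigcap_measurable => // k _; exact: bigcup_measurable.
- by move=> x Ax k _; have [[_ cov] _] := CP k; exact: cov.
- apply/lee_addgt0Pr => e e0.
  have [k ke] : exists k, (k.+1%:R^-1 : R) < e.
    have /cvgrPdist_lt/(_ _ e0)[k _ /(_ k (leqnn k))] := @cvg_harmonic R.
    by rewrite /harmonic/= sub0r normrN ger0_norm//; exists k.
  apply: (@le_trans _ _ (mu A + k.+1%:R^-1%:E)%E); last first.
    by rewrite leeD2l// lee_fin ltW.
  apply: le_trans (CP k).2; apply: (@le_trans _ _ (beta (\bigcup_i C k i))).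
    apply: le_measure; rewrite ?inE.
    + by apply: bigcap_measurable => // j _; exact: bigcup_measurable.
    + exact: bigcup_measurable.
    + by move=> x; apply.
  apply: measure_sigma_subadditive => //; exact: bigcup_measurable.
Qed.

(** If [G] is a Borel hull of [A], and [Z] one of the null set [G] minus [A], then [G] minus [Z]
    lies in [A] and misses only points of [Z]. *)
Lemma lebesgue_borel_inner (A : set X) :
  measurable (A : set (lebesgue_type R n)) -> (mu A < +oo)%E ->
  exists B Z : set X, [/\ measurable B, measurable Z, B `<=` A, A `\` B `<=` Z & beta Z = 0%E].
Proof.
move=> mA Afin; have [G [mG AG bG]] := borel_hull A.
have mG' := measurable_lebesgue_rV G mG.
have GA0 : mu (G `\` A) = 0%E.
  have GE : mu G = mu A.
    apply/eqP; rewrite eq_le lebesgue_rVE// bG/= -lebesgue_rVE//.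
    by apply: le_measure; rewrite ?inE.
  rewrite measureD//; last by rewrite [X in (X < _)%E]GE.
  rewrite setIidr// [X in (X - _)%E]GE subee// ge0_fin_numE// outer_measure_ge0.
have [Z [mZ GZ bZ]] := borel_hull (G `\` A).
exists (G `\` Z), Z; split => //.
- exact: measurableD.
- by move=> x [Gx nZ]; apply: contrapT => nA; apply: nZ; apply: GZ.
- by move=> x [Ax nGZ]; apply: contrapT => nZ; apply: nGZ; split => //; exact: AG.
- by apply/eqP; rewrite eq_le measure_ge0 andbT -GA0.
Qed.

(* For [f] merely Lebesgue measurable, [(x, w) |-> f (x + w)] need not be
   measurable for the product sigma-algebra, and Tonelli would not apply. *)
Lemma borel_representative (Omega : set X) (f : 'rV[R]_n -> R) :
  measurable Omega -> (beta Omega < +oo)%E -> (forall x, 0 <= f x) ->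
  measurable_fun (Omega : set (lebesgue_type R n)) (f : lebesgue_type R n -> R) ->
  exists (Z : set X) (w : X -> R), [/\ measurable Z, beta Z = 0%E,
    measurable_fun [set: X] w, forall x, Omega x -> ~ Z x -> w x = f x &
    forall x, ~ Omega x \/ Z x -> w x = 0].
Proof.
move=> mO Ofin f0 mf.
have mO' := measurable_lebesgue_rV Omega mO.
(* An enumeration of the rationals; 0 stands in for the integers that code no rational. *)
pose q (k : nat) : R := if unpickle k is Some r then ratr r else 0.
pose S k : set X := [set x | Omega x /\ q k < f x].
have mS k : measurable (S k : set (lebesgue_type R n)).
  rewrite (_ : S k = Omega `&` f @^-1` `]q k, +oo[); first exact: mf.
  by apply/seteqP; split => x /=; rewrite in_itv/= andbT.
have Sfin k : (mu (S k) < +oo)%E.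
  apply: le_lt_trans Ofin; rewrite -lebesgue_rVE//.
  by apply: le_measure; rewrite ?inE// => x [].
have /choice[BZ BZP] : forall k, exists BZ : set X * set X,
    [/\ measurable BZ.1, measurable BZ.2, BZ.1 `<=` S k, S k `\` BZ.1 `<=` BZ.2 & beta BZ.2 = 0%E].
  by move=> k; have [B [Z H]] := lebesgue_borel_inner _ (mS k) (Sfin k); exists (B, Z).
pose Z := \bigcup_k (BZ k).2.
have mZ : measurable Z by apply: bigcup_measurable => k _; have [] := BZP k.
have Z0 : beta Z = 0%E.
  apply/eqP; rewrite eq_le measure_ge0 andbT.
  apply: (@le_trans _ _ (\sum_(k <oo) beta (BZ k).2)%E).
    apply: measure_sigma_subadditive => // k; have [] := BZP k => //.
  by rewrite eseries0// => k _ _; have [] := BZP k.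
pose w x := if `[< Omega x /\ ~ Z x >] then f x else 0.
have wE x : Omega x -> ~ Z x -> w x = f x.
  by move=> Ox nZ; rewrite /w; case: asboolP => // -[].
have w0 x : ~ Omega x \/ Z x -> w x = 0.
  by move=> H; rewrite /w; case: asboolP => // -[Ox nZ]; case: H.
exists Z, w; split => //.
have mlev k : measurable [set x | q k < w x].
  have [qk|qk] := ltP (q k) 0.
    rewrite (_ : [set x | _] = setT)//; apply/seteqP; split => // x _ /=.
    by rewrite /w; case: ifPn => _ //; exact: lt_le_trans qk _.
  rewrite (_ : [set x | _] = (BZ k).1 `\` Z).
    by apply: measurableD => //; have [] := BZP k.
  have [_ _ BS SB _] := BZP k.
  apply/seteqP; split => x /=.
    rewrite /w; case: asboolP => [[Ox nZ]|_]; last by rewrite ltNge qk.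
    move=> qf; split => //; apply: contrapT => nB; apply: nZ; exists k => //.
    by apply: SB; split.
  by move=> [Bx nZ]; have [Ox qf] := BS _ Bx; rewrite wE.
move=> mT; apply: (measurability _ (RGenOInfty.measurableE R)) => // _ [_ [r ->] <-].
rewrite setTI (_ : _ @^-1` _ = \bigcup_k (if r < q k then [set x | q k < w x] else set0)).
  by apply: bigcup_measurable => k _; case: ifPn.
apply/seteqP; split => x /=; rewrite in_itv/= andbT.
  move=> rw; have [p] := rat_in_itvoo rw.
  rewrite in_itv/= => /andP[rp pw]; exists (pickle p) => //.
  by rewrite /q pickleK rp.
by move=> [k _]; case: ifPn => // rk /=; exact: lt_trans.
Qed.

End borel_representatives.

(** * Layer-cake formulas and the L^q norm *)

Section layer_cake.
Context d (T : measurableType d) (R : realType).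
Variable nu : {sigma_finite_measure set T -> \bar R}.
Local Notation lambda := (@lebesgue_measure R).
Local Notation pos := ([set s | (0 < s)%R] : set (measurableTypeR R)).

Lemma measurable_pos : measurable pos.
Proof. exact: measurable_ltr. Qed.

Lemma measurable_undergraph (w : T -> R) : measurable_fun setT w ->
  measurable ([set p : T * measurableTypeR R | 0 < p.2 /\ p.2 < w p.1]).
Proof.
move=> mw; apply: measurableI.
  by apply: measurable_ltr => //; exact: measurable_snd.
apply: measurable_ltr; first exact: measurable_snd.
exact: measurableT_comp mw measurable_fst.
Qed.

(** Tonelli on the undergraph of [w]. For nonnegative [w], the weight 1 gives the integral of [w];
    the weight [s ^ (q - 1)] enters the bound on the L^q norm. *)
Lemma integral_layers (w : T -> R) (g : R -> R) : measurable_fun setT w ->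
  measurable_fun [set: measurableTypeR R] g -> (forall s, 0 <= g s) ->
  (\int[nu]_x \int[lambda]_(s in [set s | (0 < s)%R /\ (s < w x)%R]) (g s)%:E =
   \int[lambda]_(s in pos) ((g s)%:E * nu [set x | (s < w x)%R]))%E.
Proof.
move=> mw mg g0.
pose Q : set (T * measurableTypeR R) := [set p | 0 < p.2 /\ p.2 < w p.1].
have mQ : measurable Q by exact: measurable_undergraph.
pose f (p : T * measurableTypeR R) : \bar R := ((g p.2)%:E * (\1_Q p)%:E)%E.
have mf : measurable_fun setT f.
  apply: emeasurable_funM; apply/measurable_EFinP; last exact: measurable_indic.
  exact: measurableT_comp mg measurable_snd.
have f0 p : (0 <= f p)%E by rewrite mule_ge0 ?lee_fin.
transitivity (\int[nu]_x \int[lambda]_s f (x, s))%E.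
  apply: eq_integral => x _; rewrite integral_mkcond; apply: eq_integral => s _.
  rewrite /patch /f indicE; case: ifPn => [/set_mem H|/negP H].
    by rewrite mem_set//= mule1.
  by rewrite memNset ?mule0// => H'; apply: H; exact/mem_set.
rewrite fubini_tonelli//.
rewrite [RHS]integral_mkcond; apply: eq_integral => s _; rewrite /patch.
case: ifPn => [/set_mem/= s0|s0].
  rewrite /f/= ge0_integralZl//; last 2 first.
  - apply/measurable_EFinP.
    have := @measurable_fun_pair1 _ _ _ T (measurableTypeR R) R (\1_Q) s; apply.
    exact: measurable_indic.
  - by rewrite lee_fin.
  congr (_ * _)%E.
  have mE : measurable [set x | s < w x] by exact: measurable_ltr.
  transitivity (nu ([set x | (s < w x)%R] `&` setT)); last by rewrite setIT.
  rewrite -integral_indic//; apply: eq_integral => x _.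
  congr EFin; rewrite !indicE; congr (nat_of_bool _)%:R.
  by apply/idP/idP => /set_mem H; apply/mem_set => //; case: H.
rewrite integral0_eq// => x _; rewrite /f indicE memNset ?mule0//.
by move=> [/= H _]; move: s0; rewrite notin_setE.
Qed.

(** Only the levels between [a / 2] and [a] are kept, where the integrand is at least
    [(a / 2) ^ (q - 1)]. No primitive is computed, at the price of the factor [2 ^ q]. *)
Lemma powR_le_layers (q a : R) : 1 <= q -> 0 <= a ->
  ((a `^ q)%:E <= (2 `^ q)%:E * \int[lambda]_(s in [set s | (0 < s)%R /\ (s < a)%R])
    (s `^ (q - 1))%:E)%E.
Proof.
move=> q1 a0.
have q0 : 0 < q by exact: lt_le_trans q1.
have [->|an0] := eqVneq a 0.
  rewrite powR0 ?gt_eqF// mule_ge0// ?lee_fin ?powR_ge0//.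
  by apply: integral_ge0 => s _; rewrite lee_fin powR_ge0.
have apos : 0 < a by rewrite lt_neqAle eq_sym an0.
have a20 : 0 < a / 2 by rewrite divr_gt0.
have -> : a `^ q = 2 `^ q * (a / 2) `^ q.
  by rewrite -powRM// ?ltW// mulrC divfK.
rewrite EFinM lee_pmul2l ?lte_fin ?powR_gt0//.
have -> : ((a / 2) `^ q)%:E = (\int[lambda]_(s in `](a / 2)%R, a[) ((a / 2) `^ (q - 1))%:E)%E.
  rewrite integral_cst//= lebesgue_measure_itv/= lte_fin.
  rewrite ltr_pdivrMr// ifT; last by lra.
  rewrite -EFinB -EFinM; congr EFin.
  rewrite (_ : a - a / 2 = a / 2); last by lra.
  by rewrite -{3}(powRr1 (ltW a20)) -powRD ?subrK// gt_eqF ?implybT// gt_eqF.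
rewrite [leLHS]integral_mkcond [leRHS]integral_mkcond.
apply: le_ge0_integral => s _; rewrite /patch.
  by case: ifPn => // _; rewrite lee_fin powR_ge0.
case: ifPn => [/set_mem/=|_].
  rewrite in_itv/= => /andP[s1 s2].
  have s0 : 0 < s by exact: lt_trans s1.
  rewrite mem_set//= lee_fin ge0_ler_powR ?nnegrE ?subr_ge0// ltW//.
by case: ifPn => // _; rewrite lee_fin powR_ge0.
Qed.

(* Monotonicity of [m] gives the weak-type bound s * m(s)^(1/q) <= Phi; inserting
   its (q - 1)-th power in \int_0^oo s^(q-1) m(s) ds yields Phi^q. *)
Lemma Lnorm_le_layers (w : T -> R) (m : R -> R) (q : R) : 1 <= q ->
  measurable_fun setT w -> (forall x, 0 <= w x) ->
  measurable_fun [set: measurableTypeR R] m -> (forall s, 0 <= m s) ->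
  (forall s t, 0 < s -> s <= t -> m t <= m s) ->
  (forall s, 0 < s -> nu [set x | s < w x] = (m s)%:E) ->
  ((\int[nu]_x (w x `^ q)%:E) `^ q^-1 <=
   2%:E * \int[lambda]_(s in pos) (m s `^ q^-1)%:E)%E.
Proof.
move=> q1 mw w0 mm m0 m_noninc mE.
have q0 : 0 < q by exact: lt_le_trans q1.
have q10 : 0 <= q - 1 by rewrite subr_ge0.
set Phi := (\int[lambda]_(s in pos) _)%E.
have Phi0 : (0 <= Phi)%E by apply: integral_ge0 => s _; rewrite lee_fin powR_ge0.
have mphi : measurable_fun [set: measurableTypeR R] (fun s => m s `^ q^-1).
  exact: (measurableT_comp (measurable_powR _)).
have [Phifin|] := boolP (Phi \is a fin_num); last first.
  by rewrite ge0_fin_numE// ltey negbK => /eqP ->; rewrite gt0_muley ?lte_fin// leey.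
pose phi := fine Phi.
have PhiE : Phi = phi%:E by rewrite fineK.
have phi0 : 0 <= phi by rewrite fine_ge0.
have weak s : 0 < s -> s * m s `^ q^-1 <= phi.
  move=> s0; rewrite -lee_fin -PhiE.
  apply: (@le_trans _ _ (\int[lambda]_(t in `]0%R, s[) (m s `^ q^-1)%:E)%E).
    rewrite integral_cst//= lebesgue_measure_itv/= lte_fin s0.
    by rewrite sube0 -EFinM mulrC.
  rewrite /Phi [leLHS]integral_mkcond [leRHS]integral_mkcond.
  apply: le_ge0_integral => t _; rewrite /patch.
    by case: ifPn => // _; rewrite lee_fin powR_ge0.
  case: ifPn => [/set_mem/=|_].
    rewrite in_itv/= => /andP[t0 ts].
    rewrite mem_set//= lee_fin ge0_ler_powR ?nnegrE ?invr_ge0 ?(ltW q0)//.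
    by apply: m_noninc => //; exact: ltW.
  by case: ifPn => // _; rewrite lee_fin powR_ge0.
suff H : (\int[nu]_x (w x `^ q)%:E <= ((2 * phi) `^ q)%:E)%E.
  rewrite PhiE -EFinM.
  have -> : (2 * phi)%:E = (((2 * phi) `^ q)%:E `^ q^-1)%E.
    by rewrite poweR_EFin -powRrM mulfV ?gt_eqF// powRr1// mulr_ge0.
  apply: gt0_ler_poweR => //.
  - by rewrite invr_ge0 ltW.
  - rewrite in_itv/= leey andbT; apply: integral_ge0 => x _.
    by rewrite lee_fin powR_ge0.
  - by rewrite in_itv/= leey andbT lee_fin powR_ge0.
pose g (s : R) := s `^ (q - 1).
have mg : measurable_fun [set: measurableTypeR R] g by exact: measurable_powR.
have g0 s : 0 <= g s by exact: powR_ge0.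
apply: (@le_trans _ _ (\int[nu]_x ((2 `^ q)%:E *
    \int[lambda]_(s in [set s | (0 < s)%R /\ (s < w x)%R]) (g s)%:E))%E).
  apply: le_ge0_integral => x _; first by rewrite lee_fin powR_ge0.
  exact: powR_le_layers.
have mI : measurable_fun setT (fun x => \int[lambda]_(s in [set s | (0 < s)%R /\ (s < w x)%R]) (g s)%:E)%E.
  pose Q : set (T * measurableTypeR R) := [set p | 0 < p.2 /\ p.2 < w p.1].
  have mQ : measurable Q by exact: measurable_undergraph.
  pose f (p : T * measurableTypeR R) : \bar R := ((g p.2)%:E * (\1_Q p)%:E)%E.
  have mf : measurable_fun setT f.
    apply: emeasurable_funM; apply/measurable_EFinP; last exact: measurable_indic.
    exact: measurableT_comp mg measurable_snd.
  have f0 p : (0 <= f p)%E by rewrite mule_ge0 ?lee_fin.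
  rewrite (_ : (fun x => _) = fubini_F lambda f); first exact: measurable_fun_fubini_tonelli_F.
  apply/funext => x; rewrite integral_mkcond; apply: eq_integral => s _.
  rewrite /patch /f indicE; case: ifPn => [/set_mem H|/negP H].
    by rewrite mem_set//= mule1.
  by rewrite memNset ?mule0// => H'; apply: H; exact/mem_set.
have q2 : (0 <= (2 `^ q)%:E)%E by rewrite lee_fin powR_ge0.
have I_ge0 x : [set: T] x ->
    (0 <= \int[lambda]_(s in [set s | (0 < s)%R /\ (s < w x)%R]) (g s)%:E)%E.
  by move=> _; apply: integral_ge0 => s _; rewrite lee_fin.
rewrite (ge0_integralZl nu measurableT mI I_ge0 q2).
rewrite integral_layers// powRM// EFinM lee_pmul2l ?lte_fin ?powR_gt0//.
apply: (@le_trans _ _ (\int[lambda]_(s in pos) ((phi `^ (q - 1))%:E * (m s `^ q^-1)%:E))%E).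
  apply: le_ge0_integral => s s0; first by rewrite mule_ge0 ?lee_fin.
  rewrite mE// -!EFinM lee_fin.
  have mq : m s = (m s `^ q^-1) `^ (q - 1) * m s `^ q^-1.
    rewrite -{2}(@powRr1 _ (m s `^ q^-1)) ?powR_ge0//.
    have [ms0|msn0] := eqVneq (m s) 0.
      by rewrite ms0 powR0 ?invr_eq0 ?gt_eqF// powRr1// mulr0.
    rewrite -powRD ?subrK; last by rewrite gt_eqF.
    by rewrite -powRrM mulVf ?gt_eqF// powRr1.
  rewrite [X in _ * X <= _]mq /g mulrA -powRM ?powR_ge0 ?(ltW s0)// ler_wpM2r ?powR_ge0//.
  by rewrite ge0_ler_powR ?nnegrE ?mulr_ge0 ?powR_ge0 ?(ltW s0)// weak.
rewrite ge0_integralZl//; first last.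
- by rewrite lee_fin powR_ge0.
- by move=> s _; rewrite lee_fin powR_ge0.
- by apply: measurable_funTS; exact/measurable_EFinP.
- exact: measurable_pos.
rewrite -/Phi PhiE -EFinM lee_fin -{2}(powRr1 phi0) -powRD ?subrK//.
by rewrite gt_eqF.
Qed.

End layer_cake.

(** * Coarea inequality for the seminorm *)

Section seminorm_layers.
Context {R : realType} {n : nat}.
Local Notation X := (borel_rV R n).
Local Notation beta := (lebesgue_borel R n).
Local Notation mu := (@lebesgue_rV R n).
Local Notation lambda := (@lebesgue_measure R).
Local Notation Rm := (measurableTypeR R).
Local Notation pos := ([set s | (0 < s)%R] : set (measurableTypeR R)).

Lemma crossing_null (A A' Z B : set X) (s : R) :
  measurable A -> measurable A' -> measurable Z -> beta Z = 0%E ->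
  A `<=` A' `|` Z -> (crossing A B s <= crossing A' B s)%E.
Proof.
move=> mA mA' mZ Z0 AA'; apply: le_ge0_integral => // y _.
have mb : measurable (ball (y : 'rV[R]_n) s : set X) by exact: measurable_ball_rV.
rewrite -[leRHS]adde0 -Z0.
apply: (@le_trans _ _ (beta ((A' `&` (ball (y : 'rV[R]_n) s : set X)) `|` Z))).
  apply: le_measure; rewrite ?inE; [exact: measurableI|by apply: measurableU => //; exact: measurableI|].
  by move=> x [Ax xs]; have [|] := AA' x Ax; [left|right].
by apply: measureU2 => //; exact: measurableI.
Qed.

(** For a pair [(y, x)], the levels [s] in [[w x, w y[] have measure at most [|u x - u y|], and the
    levels [t > 0] with [|x - y| < phi t] have measure [layer phi (x - y)]. Integrating the product
    and exchanging the order yields the energies of the superlevel sets, of which [H] is a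
    measurable majorant. *)
Lemma seminormWK1_lower (Omega Z : set X) (w : X -> R) (u : 'rV[R]_n -> R)
    (K : 'rV[R]_n -> \bar R) (phi : R -> R) (c0 : R) :
  measurable Omega -> measurable Z -> beta Z = 0%E ->
  measurable_fun setT w -> (forall x, Omega x -> ~ Z x -> w x = `|u x|) ->
  (forall x, ~ Omega x \/ Z x -> w x = 0) ->
  measurable_fun [set: measurableTypeR R] phi -> 0 < c0 ->
  (forall z, 0 <= K z)%E -> (forall z, c0%:E * layer phi z <= K z)%E ->
  exists H : Rm -> \bar R, [/\ measurable_fun setT H, forall s, (0 <= H s)%E,
    forall s, 0 < s -> (\int[lambda]_(t in pos)
      crossing (Omega `\` [set x | (s < w x)%R]) [set x | (s < w x)%R] (phi t) <= H s)%E &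
    (c0%:E * \int[lambda]_s H s <= seminormWK1 K Omega u)%E].
Proof.
move=> mO mZ Z0 mw wu w0 mphi c00 K0 LK.
pose O' : set X := Omega `\` Z.
have mO' : measurable O' by exact: measurableD.
pose Q : set ((X * X) * (Rm * Rm)) := [set p |
  ((O' p.1.1 /\ O' p.1.2) /\ (0 < p.2.1 /\ 0 < p.2.2)) /\
  ((p.2.1 < w p.1.1 /\ ~ (p.2.1 < w p.1.2)) /\
  ball (p.1.1 : 'rV[R]_n) (phi p.2.2) (p.1.2 : 'rV[R]_n))].
have m11 : measurable_fun setT (fun p : (X * X) * (Rm * Rm) => p.1.1).
  exact: measurableT_comp measurable_fst measurable_fst.
have m12 : measurable_fun setT (fun p : (X * X) * (Rm * Rm) => p.1.2).
  exact: measurableT_comp measurable_snd measurable_fst.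
have m21 : measurable_fun setT (fun p : (X * X) * (Rm * Rm) => p.2.1).
  exact: measurableT_comp measurable_fst measurable_snd.
have m22 : measurable_fun setT (fun p : (X * X) * (Rm * Rm) => p.2.2).
  exact: measurableT_comp measurable_snd measurable_snd.
have mpre (A : set X) (f : (X * X) * (Rm * Rm) -> X) : measurable_fun setT f ->
    measurable A -> measurable [set p | A (f p)].
  by move=> mf mA; rewrite -[X in measurable X]setTI; exact: mf.
have mQ : measurable Q.
  apply: measurableI; apply: measurableI; [apply: measurableI|apply: measurableI|
    apply: measurableI|].
  - exact: (mpre _ _ m11 mO').
  - exact: (mpre _ _ m12 mO').
  - exact: measurable_ltr.
  - exact: measurable_ltr.
  - by apply: measurable_ltr => //; exact: measurableT_comp mw m11.
  - apply: (@measurableC _ _ [set p : (X * X) * (Rm * Rm) | p.2.1 < w p.1.2]).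
    by apply: measurable_ltr => //; exact: measurableT_comp mw m12.
  - by apply: measurable_ball_rel => //; exact: measurableT_comp mphi m22.
pose ll : {sigma_finite_measure set (Rm * Rm)%type -> \bar R} := sfprod _ _ _ _ _ lambda lambda.
pose bb : {sigma_finite_measure set (X * X)%type -> \bar R} := sfprod _ _ _ _ _ beta beta.
pose G (p : Rm * Rm) : \bar R := bb (ysection Q p).
have mG : measurable_fun setT G by exact: measurable_fun_ysection.
have G0 p : (0 <= G p)%E by [].
exists (fun s => \int[lambda]_t G (s, t))%E; split.
- exact: (measurable_fun_fubini_tonelli_F G).
- by move=> s; exact: integral_ge0.
- move=> s s0; rewrite integral_mkcond; apply: le_ge0_integral => t _.
    by apply: erestrict_ge0 => ? _; exact: crossing_ge0.
  rewrite /patch; case: ifPn => [/set_mem/= t0|_] //.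
  set E := [set x | s < w x].
  have mE : measurable E by exact: measurable_ltr.
  (* The null set [Z] may be dropped from the exterior part; [E] avoids it already, since [w]
     vanishes there and [s > 0]. *)
  apply: (@le_trans _ _ (crossing (O' `\` E) E (phi t))).
    apply: (@crossing_null _ _ Z) => //; [exact: measurableD|exact: measurableD|].
    by move=> x [Ox nE]; have [Zx|nZ] := pselect (Z x); [right|left].
  rewrite -product_crossing_set//; last exact: measurableD.
  apply: le_measure; rewrite ?inE; [by apply: measurable_crossing_set => //; exact: measurableD|
    exact: measurable_ysection|].
  move=> p [Ey OnE yx]; have [xO nEx] := OnE.
  rewrite /ysection/= inE; split => /=; last by split.
  split; last by split.
  split => //; split.
    by apply: contrapT => nO; move: Ey; rewrite /E/= w0 ?ltNge ?(ltW s0)//; left.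
  by move=> Zy; move: Ey; rewrite /E/= w0 ?ltNge ?(ltW s0)//; right.
have swap : (\int[lambda]_s \int[lambda]_t G (s, t) =
    \int[mu]_y \int[mu]_x ll (xsection Q (y, x)))%E.
  by rewrite iterated_lebesgue_rV_xsection// -fubini_tonelli1.
have mF : measurable_fun setT (fun p : X * X => ll (xsection Q p)).
  exact: measurable_fun_xsection.
have F0 (p : X * X) : (0 <= ll (xsection Q p))%E by [].
have mF' : measurable_fun setT (fun p : X * X => (c0%:E * ll (xsection Q p))%E).
  exact: emeasurable_funM.
have F0' (p : X * X) : (0 <= c0%:E * ll (xsection Q p))%E.
  by rewrite mule_ge0// lee_fin ltW.
rewrite swap (iterated_lebesgue_rV _ mF F0) -ge0_integralZl//; last first.
  by rewrite lee_fin ltW.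
rewrite -(iterated_lebesgue_rV _ mF' F0') /seminormWK1.
have Qempty y x : ~ (O' y /\ O' x) -> xsection Q (y, x) = set0.
  move=> H; apply/seteqP; split => // p; rewrite /xsection/= inE => -[[HO _] _].
  exact: H.
rewrite [leRHS]integral_mkcond; apply: le_ge0_integral => y _.
  by apply: integral_ge0.
rewrite /patch; case: ifPn => [/set_mem Oy|nOy]; last first.
  rewrite integral0_eq// => x _; rewrite Qempty ?measure0 ?mule0// => -[[Oy _] _].
  by move: nOy; rewrite notin_setE.
rewrite [leRHS]integral_mkcond; apply: le_ge0_integral => x _ //.
rewrite /patch; case: ifPn => [/set_mem Ox|nOx]; last first.
  rewrite Qempty ?measure0 ?mule0// => -[_ [Ox _]].
  by move: nOx; rewrite notin_setE.
have [[yO xO]|nO'] := pselect (O' y /\ O' x); last first.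
  by rewrite Qempty// measure0 mule0 mule_ge0.
pose S1 : set Rm := `[w x, w y[%classic.
pose S2 : set Rm := [set t | 0 < t /\ `|(x : 'rV[R]_n) - (y : 'rV[R]_n)| < phi t].
have mS1 : measurable S1 by exact: measurable_itv.
have mS2 : measurable S2 by apply: measurableI; apply: measurable_ltr.
apply: (@le_trans _ _ (c0%:E * ll (S1 `*` S2))%E).
  rewrite lee_pmul2l//; apply: le_measure; rewrite ?inE; [exact: measurable_xsection|exact: measurableX|].
  move=> p; rewrite /xsection/= inE => -[[_ [s0 t0]] [[sy sx] yx]]; split.
    by rewrite /S1/= in_itv/= sy andbT leNgt; apply/negP.
  by split => //; move: yx; rewrite -ball_normE /ball_/= distrC.
have -> : ll (S1 `*` S2) = (lambda S1 * lambda S2)%E by exact: product_measure1E.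
rewrite muleCA lee_pmul//; first by rewrite mule_ge0// lee_fin ltW.
  rewrite /S1 lebesgue_measure_itv/= lte_fin; case: ifPn => _; last by rewrite lee_fin.
  rewrite -EFinB lee_fin.
  (* Reverse triangle inequality for [w = |u|]. *)
  move: yO xO => [? ?] [? ?]; rewrite !wu//.
  by rewrite distrC; apply: le_trans (lerB_dist _ _).
exact: LK.
Qed.

End seminorm_layers.

Lemma bounded_lebesgue_borel_lty (R : realType) (n : nat) (A : set 'rV[R]_n) :
  bounded_set A -> measurable (A : set (borel_rV R n)) ->
  (lebesgue_borel R n A < +oo)%E.
Proof.
move=> [B [Breal bA]] mA.
have B1 : 0 < `|B| + 1 by rewrite ltr_wpDl.
apply: (@le_lt_trans _ _ (lebesgue_borel R n (ball (0 : 'rV[R]_n) (`|B| + 1 + 1)))).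
  apply: le_measure; rewrite ?inE//; first exact: measurable_ball_rV.
  move=> x Ax; rewrite -ball_normE /ball_/= sub0r normrN.
  apply: (@le_lt_trans _ _ (`|B| + 1)); last by rewrite ltrDl.
  by apply: bA => //; rewrite (le_lt_trans (ler_norm _))// ltrDl.
by rewrite lebesgue_borel_ball ?ltry// ltr_wpDl// ltW.
Qed.

Lemma normL_restrict (R : realType) (n : nat) (Omega Z : set (borel_rV R n))
    (w : borel_rV R n -> R) (u : 'rV[R]_n -> R) (q : R) : 0 < q ->
  measurable Omega -> measurable Z -> lebesgue_borel R n Z = 0%E ->
  measurable_fun setT w -> (forall x, Omega x -> ~ Z x -> w x = `|u x|) ->
  (forall x, ~ Omega x \/ Z x -> w x = 0) ->
  measurable_fun (Omega : set (lebesgue_type R n)) (u : lebesgue_type R n -> R) ->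
  normL q Omega u = ((\int[lebesgue_borel R n]_x (w x `^ q)%:E) `^ q^-1)%E.
Proof.
move=> q0 mO mZ Z0 mw wu w0 mu_.
have mO' := measurable_lebesgue_rV Omega mO.
rewrite /normL unlock; congr (_ `^ _)%E.
have mwq : measurable_fun setT (fun x => (w x `^ q)%:E).
  by apply/measurable_EFinP; exact: (measurableT_comp (measurable_powR _)).
rewrite -integral_lebesgue_rV//; last by move=> x; rewrite lee_fin powR_ge0.
apply: ge0_ae_eq_integral; first exact: measurableT.
- have muO : measurable_fun [set: lebesgue_type R n] ((EFin \o u) \_ Omega).
    by apply/(measurable_restrictT _ mO'); exact/measurable_EFinP.
  apply: (measurableT_comp (measurable_poweR _)).
  exact: (measurableT_comp (@abse_measurable R setT) muO).
- exact: (@measurable_fun_lebesgue_rV R n _ _ (fun x => (w x `^ q)%:E)).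
- by move=> x _; exact: poweR_ge0.
- by move=> x _; rewrite lee_fin powR_ge0.
- exists Z; split; [exact: measurable_lebesgue_rV|by rewrite [LHS]lebesgue_rVE|].
  move=> x /= H; apply: contrapT => nZ; apply: H => _.
  rewrite /patch; case: ifPn => [/set_mem Ox|nO].
    by rewrite wu//= abse_EFin poweR_EFin.
  rewrite w0; last by left; move/negP: nO => nO Ox; apply: nO; exact/mem_set.
  by rewrite abse0 poweR0r ?powR0 ?gt_eqF.
Qed.

Theorem corollary5p4 (R : realType) (d : nat) (hd : (0 < d)%N)
  (Omega : set 'rV[R]_d)
  (Omega_bounded : bounded_set Omega)
  (Omega_open : open Omega)
  (Omega_lipschitz : lipschitz_boundary Omega)
  (N : 'rV[R]_d -> R) (N_norm : is_norm N)
  (K : 'rV[R]_d -> \bar R) (K_kernel : is_kernel K)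
  (K_monotone : exists c0 : R, [/\ 0 < c0, c0 <= 1 &
     forall x y, N x <= N y -> (c0%:E * K y <= K x)%E])
  (K_doubling : exists D CD : R, [/\ 0 < D, 0 < CD &
     forall x y, N y = 2 * N x -> N x <= D -> (K x <= CD%:E * K y)%E])
  (K_integrable : (\int[@lebesgue_rV R d]_z
     (K z * (Num.min 1 (enorm z))%:E) < +oo)%E)
  (q : R) (hq : 1 <= q)
  (K_isoperimetric : exists C1 : R, 0 < C1 /\
     forall m : R, 0 < m ->
       ((m `^ q^-1 / C1)%:E <= perimeter (fun_rearr K) (ball_vol m))%E) :
  exists C : R, 0 < C /\
    forall u : 'rV[R]_d -> R, WK1 K Omega u ->
      (normL q Omega u <= C%:E * normWK1 K Omega u)%E.
Proof.
have [K0 mK _] := K_kernel.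
have [c0 [c00 _ Kmon]] := K_monotone.
have [C1 [C10 iso]] := K_isoperimetric.
have q0 : 0 < q by exact: lt_le_trans hq.
have d0 : 0 < d%:R :> R by rewrite ltr0n.
have mO : measurable (Omega : set (borel_rV R d)) by exact: open_measurable_rV.
have Ofin := @bounded_lebesgue_borel_lty R d Omega Omega_bounded mO.
have [a [a0 a1 LK]] := layer_le_kernel K N c0 hd N_norm K0 mK c00 Kmon.
pose rho := level_radius K.
have rho0 t : 0 <= rho t by exact: level_radius_ge0.
have mrho : measurable_fun [set: measurableTypeR R] rho by exact: measurable_level_radius.
have mphi : measurable_fun [set: measurableTypeR R] (fun t => a * rho t).
  exact: measurable_funM.
have minenorm0 z : 0 <= Num.min 1 (enorm z) :> R by rewrite le_min ler01 enorm_ge0.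
(* [K] dominates [c0] times its layer, so the integrability of [K] against [min(1, |z|)] passes to
   the layer. *)
have tail h : 0 < h -> (\int[@lebesgue_measure R]_(t in
    [set t | (0 < t)%R /\ (h < a * rho t)%R]) (rho t ^+ d)%:E < +oo)%E.
  move=> h0; apply: layer_tail => //.
  apply: (@le_lt_trans _ _ (\int[@lebesgue_rV R d]_z
      (c0^-1%:E * (K z * (Num.min 1 (enorm z))%:E)))%E).
    apply: le_ge0_integral => z _; first by rewrite mule_ge0// lee_fin.
    rewrite muleA lee_wpmul2r ?lee_fin//.
    by rewrite lee_pdivlMl//; exact: LK.
  have mmin : measurable_fun [set: lebesgue_type R d] (fun z => (Num.min 1 (enorm z))%:E).
    apply: (@measurable_fun_lebesgue_rV R d _ _ (fun z => (Num.min 1 (enorm z))%:E)).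
    by apply/measurable_EFinP; apply: measurable_minr => //; exact: measurable_enorm.
  have c0V : (0 <= c0^-1%:E)%E by rewrite lee_fin invr_ge0 ltW.
  have Kmin0 z : [set: 'rV[R]_d] z -> (0 <= K z * (Num.min 1 (enorm z))%:E)%E.
    by move=> _; rewrite mule_ge0// lee_fin.
  rewrite (ge0_integralZl (@lebesgue_rV R d) measurableT (emeasurable_funM mK mmin) Kmin0 c0V).
  by rewrite lte_mul_pinfty.
have J0 z : (0 <= fun_rearr K z)%E by apply: integral_ge0 => t _; rewrite lee_fin.
have JL z : (fun_rearr K z <= layer (fun t => d%:R * rho t)%R z)%E.
  exact: fun_rearr_le_layer.
have ad : a <= d%:R by rewrite (le_trans a1)// ler1n.
have [A [A0 isoA]] := relative_isoperimetric_inequality Omega rho (fun_rearr K) a d%:R q C1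
  hd Omega_bounded Omega_open Omega_lipschitz a0 ad hq C10 rho0 mrho J0 JL tail iso.
(* The factor 2 comes from [Lnorm_le_layers], [A] from the isoperimetric inequality, and [c0^-1 + 1]
   exceeds the coefficients of both the seminorm and the L^1 norm. *)
pose C := 2 * A * (c0^-1 + 1).
have c01 : 0 < c0^-1 by rewrite invr_gt0.
have C0 : 0 < C by rewrite !mulr_gt0// addr_gt0.
exists C; split => // u [/integrableP[mu_ _] _].
have mu1 : measurable_fun (Omega : set (lebesgue_type R d)) (u : lebesgue_type R d -> R).
  exact/measurable_EFinP.
have mu2 : measurable_fun (Omega : set (lebesgue_type R d))
    ((fun x => `|u x|) : lebesgue_type R d -> R).
  exact: measurableT_comp.
have [Z [w [mZ Z0 mw wu w0]]] := borel_representative Omega (fun x => `|u x|)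
  mO Ofin (fun x => normr_ge0 _) mu2.
have w_ge0 x : 0 <= w x.
  have [Ox|nO] := pselect (Omega x); last by rewrite w0//; left.
  by have [Zx|nZ] := pselect (Z x); [rewrite w0//; right|rewrite wu].
pose E (s : R) : set (borel_rV R d) := [set x | s < w x].
have mE s : measurable (E s) by exact: measurable_ltr.
have EO s : 0 < s -> E s `<=` Omega.
  move=> s0 x; apply: contraPP => nO; rewrite /E/= w0; last by left.
  by apply/negP; rewrite -leNgt ltW.
(* [E s] is the whole space for [s < 0]; intersecting with [Omega] keeps the measure finite, and [m]
   nonincreasing, on the whole line. *)
pose m s : R := fine (lebesgue_borel R d (Omega `&` E s)).
have mOE s : measurable (Omega `&` E s : set (borel_rV R d)) by exact: measurableI.
have finOE s : lebesgue_borel R d (Omega `&` E s) = (m s)%:E.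
  rewrite fineK// ge0_fin_numE//; apply: le_lt_trans Ofin.
  by apply: le_measure; rewrite ?inE.
have m0 s : 0 <= m s by rewrite fine_ge0.
have m_noninc s t : s <= t -> m t <= m s.
  move=> st; rewrite -lee_fin -!finOE; apply: le_measure; rewrite ?inE//.
  by move=> x [Ox Et]; split => //; exact: le_lt_trans st Et.
have mEs s : 0 < s -> lebesgue_borel R d (E s) = (m s)%:E.
  by move=> s0; rewrite -finOE setIidr//; exact: EO.
have mm : measurable_fun [set: measurableTypeR R] m.
  rewrite (_ : m = -%R \o (fun s => - m s)); last first.
    by apply/funext => s /=; rewrite opprK.
  apply: measurableT_comp => //.
  by apply: nondecreasing_measurable => // s t st; rewrite lerN2 m_noninc.
have [H [mH H0 HG Hu]] := seminormWK1_lower Omega Z w u K (fun t => a * rho t) c0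
  mO mZ Z0 mw wu w0 mphi c00 K0 LK.
set I1 := (\int[@lebesgue_measure R]_s H s)%E in Hu.
have I10 : (0 <= I1)%E by exact: integral_ge0.
have normLE p : 0 < p -> normL p Omega u =
    ((\int[lebesgue_borel R d]_x (w x `^ p)%:E) `^ p^-1)%E.
  by move=> p0; exact: (@normL_restrict R d Omega Z).
have mpos := @measurable_pos R.
have I2E : (\int[@lebesgue_measure R]_(s in [set s | (0 < s)%R]) (m s)%:E = normL 1 Omega u)%E.
  rewrite normLE// invr1 poweRe1; last by apply: integral_ge0 => x _; rewrite lee_fin powR_ge0.
  transitivity (\int[@lebesgue_measure R]_(s in [set s | (0 < s)%R])
      ((cst 1 s)%:E * lebesgue_borel R d [set x | (s < w x)%R]))%E.
    by apply: eq_integral => s /set_mem/= s0; rewrite mul1e -mEs.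
  rewrite -integral_layers//; apply: eq_integral => x _.
  rewrite powRr1//.
  transitivity (\int[@lebesgue_measure R]_(s in `]0%R, (w x)[) (cst 1%E s))%E.
    rewrite (_ : [set s | _] = `]0%R, (w x)[%classic)//.
    apply/seteqP; split => s /=; rewrite in_itv/=; last by move/andP.
    by move=> [-> ->].
  rewrite integral_cst//= mul1e.
  rewrite lebesgue_measure_itv/= lte_fin; case: ifPn => [_|]; first by rewrite sube0.
  by rewrite -leNgt => wx; apply/eqP; rewrite eq_le !lee_fin wx w_ge0.
(* The relative isoperimetric inequality is integrated over the superlevel sets of [w]. *)
have Phi_le : (\int[@lebesgue_measure R]_(s in [set s | (0 < s)%R]) (m s `^ q^-1)%:E <=
    A%:E * (I1 + normL 1 Omega u))%E.
  rewrite -I2E.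
  apply: (@le_trans _ _ (\int[@lebesgue_measure R]_(s in [set s | (0 < s)%R])
      (A%:E * (H s + (m s)%:E)))%E).
    apply: le_ge0_integral => s s0; first by rewrite lee_fin powR_ge0.
    apply: le_trans (isoA (E s) (m s) (mE s) (EO s s0) (mEs s s0)) _.
    by rewrite lee_pmul2l// leeD2r//; exact: HG.
  rewrite ge0_integralZl//; first last.
  - by rewrite lee_fin ltW.
  - by move=> s _; rewrite adde_ge0// lee_fin.
  - apply: emeasurable_funD; first exact: measurable_funTS.
    by apply: measurable_funTS; exact/measurable_EFinP.
  rewrite lee_pmul2l// ge0_integralD//; first last.
  - by apply: measurable_funTS; exact/measurable_EFinP.
  - by move=> s _; rewrite lee_fin.
  - exact: measurable_funTS.
  rewrite leeD2r// /I1 [leLHS]integral_mkcond; apply: le_ge0_integral => s _.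
    exact: erestrict_ge0.
  by rewrite /patch; case: ifPn.
rewrite normLE//.
apply: le_trans (@Lnorm_le_layers _ _ R (lebesgue_borel R d) w m q hq mw w_ge0 mm m0 _ mEs) _.
  by move=> s t _; exact: m_noninc.
have N10 : (0 <= normL 1 Omega u)%E by exact: Lnorm_ge0.
apply: (@le_trans _ _ (2%:E * (A%:E * (I1 + normL 1 Omega u)))%E).
  by rewrite lee_pmul2l.
have S0 : (0 <= seminormWK1 K Omega u)%E.
  by apply: le_trans Hu; rewrite mule_ge0// lee_fin ltW.
have I1u : (I1 <= c0^-1%:E * seminormWK1 K Omega u)%E by rewrite -lee_pdivrMl// invrK.
rewrite /normWK1 /C muleA -EFinM [leRHS](_ : _ = (2 * A)%:E * ((c0^-1 + 1)%:E *
  (normL 1 Omega u + seminormWK1 K Omega u)))%E; last by rewrite muleA -EFinM.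
rewrite lee_pmul2l ?lte_fin ?mulr_gt0//.
rewrite EFinD ge0_muleDl ?lee_fin ?(ltW c01)// mul1e.
rewrite (ge0_muleDr _ N10 S0) addeACA.
rewrite [leLHS]addeC; apply: leeD.
  by rewrite leeDr// mule_ge0// lee_fin ltW.
by apply: le_trans I1u _; rewrite leeDl.
Qed.
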